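(* For every $\mathcal{A}\in\mathfrak{A}$ and every $\gamma\in\mathfrak{G}_1$, $$\langle\!\langle d\mathcal{A},\gamma\rangle\!\rangle=\langle\!\langle \mathcal{A},\partial\gamma\rangle\!\rangle .$$
   Context: A (based) arrow diagram of degree $n$ is an oriented real line with $n$ abstract oriented chords (''arrows''), each having a tail and a head, attached at $2n$ distinct points. Diagrams are considered up to orientation-preserving homeomorphisms of the line. A (based) Gauss diagram is an arrow diagram in which each arrow carries a sign $\pm1$. $\mathfrak{G}$ denotes the $\mathbb{Q}$-vector space with basis the Gauss diagrams, and $\mathfrak{A}$ the $\mathbb{Q}$-vector space with basis the arrow diagrams. $\langle\,,\rangle$ denotes the scalar product for which the relevant basis (Gauss diagrams, resp. germs below) is orthonormal. Edges and signs. The complement of the arrow endpoints in the line consists of segments called edges. For an edge $e$ bounded by endpoints of two different arrows, set $\eta(e)=+1$ if these two arrows cross each other (their endpoints interlace along the line) and $-1$ otherwise. Let $\uparrow(e)$ be the number of arrowheads among the two boundary endpoints of $e$. Put $\varepsilon(e)=\eta(e)(-1)^{\uparrow(e)}$, and let $\mathrm{w}(e)$ be the product of the signs of the two arrows bounding $e$. R-moves on Gauss diagrams. - R$_1$: birth or death of an arrow, with any sign and direction, whose two endpoints are adjacent (no other endpoint lies between them). - R$_2$: birth or death of two arrows of opposite signs whose heads are adjacent and whose tails are adjacent. - R$_3$: consider three arrows $a,b,c$ and three edges $e_1,e_2,e_3$ such that each edge is bounded by endpoints of two of these arrows and each pair of the arrows bounds exactly one of these edges. The move simultaneously swaps the two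 endpoints bounding each $e_i$. It is allowed when both of the following hold: (1) $\mathrm{w}(e_i)\varepsilon(e_i)$ is the same for $i=1,2,3$; (2) the numbers $\uparrow(e_1),\uparrow(e_2),\uparrow(e_3)$ are pairwise distinct. Germs. For $i=1,2,3$, an $i$-germ is an ordered pair $(G_0,G_1)$ of Gauss diagrams that differ by one R$_i$-move. The edges involved in the move are recorded as ''distinguished'', and an arrow adjacent to a distinguished edge is called distinguished. Arrows of $G_0$ and $G_1$ not involved in the move correspond naturally to each other. - A partial 3-germ is obtained from a 3-germ by removing one of the three distinguished arrows from both diagrams. - A subgerm of a germ $(G_0,G_1)$ is obtained by removing a set of arrows from $G_0$ together with their counterparts in $G_1$. For $i=1,2$ no distinguished arrow may be removed; for $i=3$ at most one distinguished arrow may be removed. Thus a subgerm is either a germ or a partial 3-germ. - Arrow germs and partial arrow germs are defined in the same way, with unsigned arrows (they are the sign-forgettings of germs and partial germs). Spaces of germs. $\mathfrak{G}_I,\mathfrak{G}_{II},\mathfrak{G}_\Delta,\mathfrak{G}_\Lambda$ are the $\mathbb{Q}$-spaces spanned by 1-germs, 2-germs, 3-germs and partial 3-germs respectively, with relations $(x,y)+(y,x)=0$ in the R$_3$ cases. The spaces $\mathfrak{A}^I,\mathfrak{A}^{II},\mathfrak{A}^\Delta,\mathfrak{A}^\Lambda$ are the analogous spaces of arrow germs. Set $\mathfrak{G}_1=\mathfrak{G}_I\oplus\mathfrak{G}_{II}\oplus\mathfrak{G}_\Delta$. Maps. - $\partial:\mathfrak{G}_1\to\mathfrak{G}$ is given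 by $\partial(G_0,G_1)=G_1-G_0$. - For an arrow diagram or arrow germ $\alpha$ with $n$ arrows, $S(\alpha)=\sum_{\sigma\in\{\pm1\}^n}\mathrm{sign}(\sigma)\,\alpha^\sigma$. Here $\alpha^\sigma$ is the signed version of $\alpha$ (signs assigned consistently to corresponding arrows of both diagrams of a germ), $\mathrm{sign}(\sigma)$ is the product of the signs, and only those $\alpha^\sigma$ that are genuine Gauss diagrams, germs or partial germs contribute. - $I(G)$ is the formal sum of all $2^{\deg G}$ subdiagrams of a Gauss diagram $G$, and $I:\mathfrak{G}_1\to\mathfrak{G}_1\oplus\mathfrak{G}_\Lambda$ sends a germ to the formal sum of its subgerms. Pairings. For $A\in\mathfrak{A}$ and $G\in\mathfrak{G}$, set $\langle\!\langle A,G\rangle\!\rangle=\langle S(A),I(G)\rangle$. For $\alpha\in\mathfrak{A}^I\oplus\mathfrak{A}^{II}\oplus\mathfrak{A}^\Delta\oplus\mathfrak{A}^\Lambda$ and $\gamma\in\mathfrak{G}_1$, set $\langle\!\langle \alpha,\gamma\rangle\!\rangle=\langle S(\alpha),I(\gamma)\rangle$. Both are extended bilinearly. Coboundary. For an arrow diagram $A$, $dA$ is the formal sum of all arrow 1-, 2-, 3-germs and partial arrow 3-germs $(A^0,A^1)$ such that $A^1$, after forgetting which edges are distinguished, equals $A$, and such that $A^1$ has at least as many arrows as $A^0$. $d$ is extended linearly to $\mathfrak{A}$.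
   Formalization: 1-germs and 2-germs (G_0,G_1) are taken only as births (G_1 has the new arrows); death germs are excluded, since with no relation (x,y)+(y,x)=0 for R_1, R_2 the identity fails, e.g. for γ=(isolated arrow, empty) and A that arrow. *)

(* Defs.v *)
From HB Require Import structures.
From mathcomp Require Import all_boot all_order all_algebra.
From Stdlib Require Import ClassicalEpsilon.

Set Implicit Arguments.
Unset Strict Implicit.
Unset Printing Implicit Defensive.

Import GRing.Theory Num.Theory.

Definition dec (P : Prop) : bool :=
  if excluded_middle_informative P then true else false.

(* Diagrams.  A diagram with N = 2n endpoints is the list of its
   endpoints in the order of the (oriented) line, positions 0..N-1.
   Endpoint j is encoded by ((partner position, is_head), label).
   This encoding is canonical: it does not depend on names of arrows,
   hence two diagrams are equal iff they are related by an
   orientation-preserving homeomorphism of the line.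
   Arrow diagrams: label = unit.  Gauss diagrams: label = sign
   (true = +1, false = -1).                                            *)
Definition ep (L : Type) := ((nat * bool) * L)%type.
Definition diag (L : Type) := seq (ep L).
Definition adiag := diag unit.
Definition gdiag := diag bool.

Section Diagrams.
Variable L : Type.
Implicit Types (D : diag L) (m : bitseq).

Definition ptn D j : nat := (nth (0%N, false) (map fst D) j).1.
Definition hd D j : bool := (nth (0%N, false) (map fst D) j).2.

Definition wf D : bool :=
  all (fun j => [&& ptn D j < size D, ptn D j != j,
                    ptn D (ptn D j) == j & hd D (ptn D j) != hd D j])
      (iota 0 (size D)).

Definition narrows D := (size D)./2.

(* an arrow is named by the smaller of its two endpoint positions;
   arrows are indexed 0..n-1 in increasing order of that position *)
Definition aid D j := minn j (ptn D j).
Definition arrow_index D j :=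
  count (fun i => i < ptn D i) (iota 0 (aid D j)).

Definition amask D (tau : bitseq) : bitseq :=
  [seq nth false tau (arrow_index D j) | j <- iota 0 (size D)].

(* new position of old position k after keeping the positions of m;
   also the image of edge k (the edge just before endpoint k) *)
Definition newpos m k := count id (take k m).

Definition restr D m : diag L :=
  map (fun y => ((newpos m y.1.1, y.1.2), y.2)) (mask m D).

(* Edges: edge k (0 <= k <= N) is the segment just before endpoint k;
   for 0 < k < N it is bounded by endpoints k-1 and k.
   swap D E : simultaneously swap the two endpoints bounding each
   edge of E. *)
Definition swp (E : seq nat) j :=
  if j.+1 \in E then j.+1 else if (0 < j) && (j \in E) then j.-1 else j.
Definition swap D (E : seq nat) : diag L :=
  match D with
  | [::] => [::]
  | x0 :: _ => mkseq (fun j => let y := nth x0 D (swp E j) in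
                               ((swp E y.1.1, y.1.2), y.2)) (size D)
  end.

Definition interlace D x y : bool :=
  let a1 := minn x (ptn D x) in let a2 := maxn x (ptn D x) in
  (a1 < y < a2) != (a1 < ptn D y < a2).

Definition up D e : nat := hd D e.-1 + hd D e.

Fixpoint bseqs (n : nat) : seq bitseq :=
  if n is n'.+1 then [seq b :: s | b <- [:: true; false], s <- bseqs n']
  else [:: [::]].

End Diagrams.

Definition sgn (G : gdiag) j : bool := nth true (map snd G) j.

Definition wf_gd (G : gdiag) : bool :=
  wf G && all (fun j => sgn G (ptn G j) == sgn G j) (iota 0 (size G)).

Definition forgetD (G : gdiag) : adiag := [seq (x.1, tt) | x <- G].

Definition signD (A : adiag) (sigma : bitseq) : gdiag :=
  [seq (x.2.1, nth true sigma (arrow_index A x.1)) | x <- zip (iota 0 (size A)) A].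

Definition sgnr (sigma : bitseq) : rat := ((-1) ^+ count negb sigma)%R.

Definition lc (T : Type) := seq (rat * T).

(* Germs.  A germ (G0,G1) with its distinguished edges is encoded by
   (kind, G1, D1) where kind = 1 (R1), 2 (R2), 3 (R3), 4 (partial R3),
   G1 is the second diagram and D1 the (increasing) list of its
   distinguished edges; the first diagram G0 and its distinguished
   edges D0 are computed by g0 / d0 below.             *)
Definition germ (L : Type) := (nat * diag L * seq nat)%type.

Section Germs.
Variable L : Type.
Implicit Types (g : germ L).

Definition kind g : nat := g.1.1.
Definition g1 g : diag L := g.1.2.
Definition d1 g : seq nat := g.2.

Definition nmask (D : diag L) (E : seq nat) : bitseq :=
  [seq ~~ ((j.+1 \in E) || (j \in E)) | j <- iota 0 (size D)].

Definition g0 g : diag L :=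
  if kind g <= 2 then restr (g1 g) (nmask (g1 g) (d1 g))
  else swap (g1 g) (d1 g).
Definition d0 g : seq nat :=
  if kind g <= 2 then undup [seq newpos (nmask (g1 g) (d1 g)) e | e <- d1 g]
  else d1 g.

Definition rev_germ g : germ L := (kind g, g0 g, d1 g).

Definition darrs g : seq nat :=
  undup [seq arrow_index (g1 g) j | j <- flatten [seq [:: e.-1; e] | e <- d1 g]].

Definition kept m e := nth false m e.-1 && nth false m e.
Definition subg g (m : bitseq) : germ L :=
  (if (kind g == 3) && ~~ all (kept m) (d1 g) then 4 else kind g,
   restr (g1 g) m,
   [seq newpos m e | e <- d1 g & kept m e]).

Definition allowed g (tau : bitseq) : bool :=
  let r := count (fun a => ~~ nth false tau a) (darrs g) in
  if kind g <= 2 then r == 0 else (kind g == 3) && (r <= 1).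

End Germs.

Definition is_germ1 (g : germ bool) : Prop :=
  exists e, [/\ kind g = 1, wf_gd (g1 g), d1 g = [:: e],
     0 < e < size (g1 g) & ptn (g1 g) e.-1 = e].

Definition is_germ2 (g : germ bool) : Prop :=
  exists e f, let G := g1 g in
   [/\ kind g = 2, wf_gd G, d1 g = [:: e; f], [/\ 0 < e, e.+1 < f & f < size G]
     & [/\ (ptn G e.-1 = f.-1 /\ ptn G e = f) \/ (ptn G e.-1 = f /\ ptn G e = f.-1),
          hd G e.-1 = hd G e & sgn G e.-1 <> sgn G e]].

(* sign parity of w(e) * eps(e)  (true iff it equals -1) *)
Definition weps (G : gdiag) e : bool :=
  (~~ interlace G e.-1 e) (+) odd (up G e) (+) (sgn G e.-1 != sgn G e).

Definition same_pair (p q : nat * nat) : bool :=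
  ((p.1 == q.1) && (p.2 == q.2)) || ((p.1 == q.2) && (p.2 == q.1)).

Definition r3_allowed (G : gdiag) (e1 e2 e3 : nat) : Prop :=
  let ar e := (aid G e.-1, aid G e) in
  [/\ 0 < e1, e1.+1 < e2, e2.+1 < e3 & e3 < size G]
  /\ [/\ (ar e1).1 <> (ar e1).2, (ar e2).1 <> (ar e2).2, (ar e3).1 <> (ar e3).2,
         size (undup [:: (ar e1).1; (ar e1).2; (ar e2).1; (ar e2).2;
                         (ar e3).1; (ar e3).2]) = 3
       & [/\ ~~ same_pair (ar e1) (ar e2), ~~ same_pair (ar e1) (ar e3)
           & ~~ same_pair (ar e2) (ar e3)]]
  /\ (weps G e1 = weps G e2 /\ weps G e2 = weps G e3)
  /\ [/\ up G e1 <> up G e2, up G e1 <> up G e3 & up G e2 <> up G e3].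

Definition is_germ3 (g : germ bool) : Prop :=
  exists e1 e2 e3, [/\ kind g = 3, wf_gd (g1 g), d1 g = [:: e1; e2; e3]
                     & r3_allowed (g0 g) e1 e2 e3].

Definition is_germ4 (g : germ bool) : Prop :=
  exists (h : germ bool) a, [/\ is_germ3 h, a \in darrs h &
     g = subg h (amask (g1 h) [seq i != a | i <- iota 0 (narrows (g1 h))])].

Definition is_germ (g : germ bool) : Prop :=
  match kind g with
  | 1 => is_germ1 g | 2 => is_germ2 g | 3 => is_germ3 g | 4 => is_germ4 g
  | _ => False
  end.

Definition is_germ_G1 (g : germ bool) : Prop := is_germ g /\ kind g \in [:: 1; 2; 3].

Definition forget_germ (g : germ bool) : germ unit := (kind g, forgetD (g1 g), d1 g).
Definition sign_germ (a : germ unit) (sigma : bitseq) : germ bool :=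
  (kind a, signD (g1 a) sigma, d1 a).

Definition is_agerm (a : germ unit) : Prop :=
  exists g, is_germ g /\ forget_germ g = a.

Definition spD (x y : lc gdiag) : rat :=
  (\sum_(u <- x) \sum_(v <- y) u.1 * v.1 * (u.2 == v.2)%:R)%R.

(* basis of germs orthonormal, with (x,y) = -(y,x) for R3 / partial R3 *)
Definition bG (g h : germ bool) : rat :=
  if g == h then 1%R
  else if (3 <= kind g) && (h == rev_germ g) then (-1)%R else 0%R.

Definition spG (x y : lc (germ bool)) : rat :=
  (\sum_(u <- x) \sum_(v <- y) u.1 * v.1 * bG u.2 v.2)%R.

Definition lin (T U : Type) (f : T -> lc U) (x : lc T) : lc U :=
  flatten [seq [seq ((u.1 * v.1)%R, v.2) | v <- f u.2] | u <- x].

Definition S_d (A : adiag) : lc gdiag :=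
  [seq (sgnr s, signD A s) | s <- bseqs (narrows A)].
Definition S_g (a : germ unit) : lc (germ bool) :=
  [seq (sgnr s, sign_germ a s) | s <- bseqs (narrows (g1 a))
                                & dec (is_germ (sign_germ a s))].

Definition I_d (G : gdiag) : lc gdiag :=
  [seq (1%R, restr G (amask G t)) | t <- bseqs (narrows G)].
Definition I_g (g : germ bool) : lc (germ bool) :=
  [seq (1%R, subg g (amask (g1 g) t)) | t <- bseqs (narrows (g1 g)) & allowed g t].

Definition bd_g (g : germ bool) : lc gdiag := [:: (1%R, g1 g); ((-1)%R, g0 g)].

Fixpoint subs (s : seq nat) : seq (seq nat) :=
  if s is x :: s' then [seq x :: t | t <- subs s'] ++ subs s' else [:: [::]].
Definition d_d (A : adiag) : lc (germ unit) :=
  [seq (1%R, a) | a <- [seq (k, A, E) | k <- [:: 1; 2; 3; 4],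
                                       E <- subs (iota 0 (size A).+1)]
                & dec (is_agerm a /\ size (g0 a) <= size (g1 a))].

Definition pairD (x : lc adiag) (y : lc gdiag) : rat := spD (lin S_d x) (lin I_d y).
Definition pairG (x : lc (germ unit)) (y : lc (germ bool)) : rat :=
  spG (lin S_g x) (lin I_g y).

(* Main.v *)
Require Import Defs.
From mathcomp Require Import all_boot all_order all_algebra.
From mathcomp Require Import zify.

(* Pairing a diagram [A] with a Gauss diagram [G] sums, over the subdiagrams of
   [G] that forget to [A], the product of their signs, so the right-hand side is
   such a sum over the arrow subsets of G_1 minus the same sum for G_0.  The
   subsets whose subgerm is a germ or a partial 3-germ give exactly the left-hand
   side, because [(x, y) = - (y, x)] produces the G_0 term for the third move.
   The other subsets contribute nothing to the difference: those avoiding the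
   distinguished edges occur in both diagrams, and those containing exactly one
   arrow of a second move cancel in pairs, the two arrows having opposite signs.
   Arrow subsets are handled as bit masks on endpoint positions that are
   invariant under the partner involution: unlike arrow indices, these are
   transported by an edge swap simply by precomposing with it. *)

Set Implicit Arguments.
Unset Strict Implicit.
Unset Printing Implicit Defensive.

Import GRing.Theory.

(** * Positions surviving a mask *)

(** [bG] encodes the relation (x,y) = -(y,x) by a case distinction that takes the value 1 on a germ
    equal to its own reverse, where the relation would force 0. The formula for the pairing is
    therefore derived for germs that differ from their reverse, and the geometric obstacle is to
    show this for every allowed subgerm of a third move. That takes an edge of the move with both
    ends surviving, found by a pigeonhole argument on the three arrows, and the fact that no two of
    the three edges join the same pair of arrows. The latter fact also makes the crossing toggle at
    each edge, so that w times epsilon changes sign at all three edges at once and the conditions of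
    the third move are symmetric in its two diagrams. Edge swaps serve the second move as well:
    swapping at its two distinguished edges exchanges its two arrows and leaves the unsigned diagram
    unchanged, which provides the sign-reversing involution behind the cancellation. *)

Lemma newposS m k : newpos m k.+1 = newpos m k + nth false m k.
Proof.
rewrite /newpos; elim: m k => [|b m IH] [|k] //=; first by rewrite take0 addn0.
by rewrite IH addnA.
Qed.

Lemma newpos0 m : newpos m 0 = 0. Proof. by rewrite /newpos take0. Qed.

Lemma newpos_mono m j k : j <= k -> newpos m j <= newpos m k.
Proof.
elim: k => [|k IH]; first by rewrite leqn0 => /eqP->.
by rewrite leq_eqVlt newposS => /orP[/eqP->|/IH]; rewrite ?newposS //; lia.
Qed.

Lemma newpos_lt m j k : nth false m j -> j < k -> newpos m j < newpos m k.
Proof. by move=> mj /(newpos_mono m); rewrite newposS mj addn1. Qed.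

Lemma newpos_ltE m j k : nth false m j -> nth false m k -> (newpos m j < newpos m k) = (j < k).
Proof.
move=> mj mk; apply/idP/idP; last exact: newpos_lt.
by rewrite !ltnNge; apply: contra => /(newpos_mono m).
Qed.

Lemma newpos_inj m j k :
  nth false m j -> nth false m k -> newpos m j = newpos m k -> j = k.
Proof.
move=> mj mk E; apply/eqP; rewrite eqn_leq leqNgt -(newpos_ltE mk mj) E ltnn /=.
by rewrite leqNgt -(newpos_ltE mj mk) E ltnn.
Qed.

Lemma newpos_eqE m j k :
  nth false m j -> nth false m k -> (newpos m j == newpos m k) = (j == k).
Proof. by move=> mj mk; apply/eqP/eqP => [/newpos_inj->|->]. Qed.

Lemma newpos_size m : newpos m (size m) = count id m.
Proof. by rewrite /newpos take_size. Qed.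

Lemma mask_lt_size m j : nth false m j -> j < size m.
Proof. by move=> mj; rewrite ltnNge; apply: contraL mj => /(nth_default false)->. Qed.

Lemma newpos_lt_count m j : nth false m j -> newpos m j < count id m.
Proof. by move=> mj; rewrite -newpos_size; apply: newpos_lt (mask_lt_size mj). Qed.

Lemma newpos_surj m p :
  p < count id m -> exists2 j, nth false m j & p = newpos m j.
Proof.
rewrite -newpos_size; elim: (size m) => [|k IH]; first by rewrite newpos0.
rewrite newposS; have [/IH//|le_p] := ltnP p (newpos m k).
by case mk: (nth false m k) => lt_p; [exists k => //; lia | lia].
Qed.

Lemma newpos_pred m e : kept m e -> 0 < e -> newpos m e = (newpos m e.-1).+1.
Proof. by case: e => // e /andP[/= me _] _; rewrite newposS me addn1. Qed.

Lemma nth_mask_newpos (T : Type) (x0 : T) m s j :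
  nth false m j -> nth x0 (mask m s) (newpos m j) = nth x0 s j.
Proof.
rewrite /newpos; elim: m s j => [|b m IH] [|x s] [|j] //=; rewrite ?nth_nil //.
- by move=> ->.
- by case: b => /= /IH <-.
Qed.

Lemma eq_bitseq (m n : bitseq) :
  size m = size n -> (forall j, nth false m j = nth false n j) -> m = n.
Proof. by move=> eq_sz eq_mn; apply: (eq_from_nth (x0 := false)). Qed.

Lemma count_id_mask (m n : bitseq) :
  size m = size n -> (forall j, nth false m j -> nth false n j) ->
  count id (mask n m) = count id m.
Proof.
elim: m n => [|a m IH] [|b n] //= [eq_sz] le_mn.
have {}IH := IH n eq_sz (fun j => le_mn j.+1).
by case: b le_mn => /= [_|/(_ 0)/=]; rewrite ?IH //; case: a => // /(_ isT).
Qed.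

Lemma newpos_mask (m n : bitseq) j :
  size m = size n -> (forall i, nth false m i -> nth false n i) ->
  newpos (mask n m) (newpos n j) = newpos m j.
Proof.
rewrite /newpos; elim: m n j => [|a m IH] [|b n] [|j] //= [eq_sz] le_mn; rewrite ?take0 //.
have {}IH := IH n j eq_sz (fun j => le_mn j.+1).
by case: b le_mn => /= [_|/(_ 0)/=]; rewrite ?IH //; case: a => // /(_ isT).
Qed.

(** * Edge swaps *)

(** Inner edges in increasing order with gaps of at least two, so that the endpoint pairs at
    distinct edges are disjoint. This is what makes [swp E] an involution. *)
Definition sep N (E : seq nat) :=
  sorted (fun x y => x.+1 < y) E && all (fun e => 0 < e < N) E.

Lemma sep_rel_trans : transitive (fun x y => x.+1 < y).
Proof. by move=> y x z; lia. Qed.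

Lemma sepP N E : sep N E ->
  [/\ forall e, e \in E -> 0 < e < N & forall e, e \in E -> e.+1 \notin E].
Proof.
case/andP=> srtE /allP inE; split=> // e; elim: E srtE {inE} => //= x E IH pE.
have/allP ltE := order_path_min sep_rel_trans pE.
rewrite !inE negb_or => /orP[/eqP->|eE].
  apply/andP; split; first by lia.
  by apply/negP=> /ltE; rewrite ltnn.
by rewrite IH ?(path_sorted pE) // andbT; move: (ltE _ eE); lia.
Qed.

Section Swap.
Variables (N : nat) (E : seq nat).
Hypothesis sepE : sep N E.

Let bndE e : e \in E -> 0 < e < N. Proof. by case: (sepP sepE) => H _; apply: H. Qed.
Let sepS e : e \in E -> (e.+1 \in E) = false.
Proof. by case: (sepP sepE) => _ H /H/negbTE. Qed.

Lemma swp_pred e : e \in E -> swp E e.-1 = e.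
Proof. by move=> eE; have /andP[e0 _] := bndE eE; rewrite /swp prednK // eE. Qed.

Lemma swp_edge e : e \in E -> swp E e = e.-1.
Proof. by move=> eE; have /andP[e0 _] := bndE eE; rewrite /swp sepS // eE e0. Qed.

Variant swp_spec k : nat -> Prop :=
| SwpUp of k.+1 \in E & k \notin E : swp_spec k k.+1
| SwpDown of 0 < k & k \in E & k.+1 \notin E : swp_spec k k.-1
| SwpId of k \notin E & k.+1 \notin E : swp_spec k k.

Lemma swpP k : swp_spec k (swp E k).
Proof.
rewrite /swp; case: ifPn => [k1|k1].
  by constructor=> //; apply/negP => /sepS; rewrite k1.
case: ifPn => [/andP[k0 kE]|]; first by constructor.
rewrite negb_and -leqNgt leqn0 => /orP[/eqP k0|kE]; constructor=> //.
by apply/negP=> /bndE; rewrite k0.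
Qed.

Lemma swpK : involutive (swp E).
Proof.
move=> k; case: (swpP k) => [k1 _|_ k0 _|k0 k1]; first exact: swp_edge.
  exact: swp_pred.
by rewrite /swp (negbTE k0) (negbTE k1) andbF.
Qed.

Lemma swp_ltN k : (swp E k < N) = (k < N).
Proof.
suff H j : j < N -> swp E j < N by apply/idP/idP => [/H|/H//]; rewrite swpK.
by case: swpP => [/bndE|_ /bndE|]; lia.
Qed.

(** Disjoint adjacent transpositions reverse the order of two positions only if these two are
    exchanged with each other. *)
Lemma swp_homo j k : j < k -> swp E j <> k -> swp E j < swp E k.
Proof.
case: (swpP j) => [j1 j0|p0 j1 j0|j0 j1];
  case: (swpP k) => [k1 k0|q0 k1 k0|k0 k1] lt_jk jk; try lia.
  - have : k != j.+2 by apply: contraTneq k1 => ->; rewrite sepS.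
    by lia.
  - have : k != j.+1 by apply: contraNneq j1 => <-.
    by lia.
Qed.

Lemma swp_lt j k : swp E j <> k -> (swp E j < swp E k) = (j < k).
Proof.
move=> njk; apply/idP/idP => [lt_s|lt_jk]; last exact: swp_homo.
rewrite -(swpK j) -(swpK k); apply: swp_homo => //.
by rewrite swpK => jk; apply: njk; rewrite jk swpK.
Qed.

End Swap.

Definition pull (E : seq nat) (m : bitseq) : bitseq :=
  [seq nth false m (swp E j) | j <- iota 0 (size m)].

(** An edge that loses an end merges into a longer one and no longer counts as distinguished. *)
Definition kept_edges (m : bitseq) E := [seq newpos m e | e <- E & kept m e].

Lemma size_pull E m : size (pull E m) = size m.
Proof. by rewrite size_map size_iota. Qed.

Section Pull.
Variables (E : seq nat) (m : bitseq).
Hypothesis sepE : sep (size m) E.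

Lemma nth_pull j : nth false (pull E m) j = nth false m (swp E j).
Proof.
have [lt_j|ge_j] := ltnP j (size m); first by rewrite (nth_map 0) ?size_iota // nth_iota.
by rewrite !nth_default // ?size_pull // leqNgt (swp_ltN sepE) -leqNgt.
Qed.

Lemma pullK : pull E (pull E m) = m.
Proof.
apply: eq_bitseq => [|j]; first by rewrite !size_pull.
have [lt_j|ge_j] := ltnP j (size m); last by rewrite !nth_default ?size_pull.
rewrite (nth_map 0) ?size_iota ?size_pull // nth_iota // add0n nth_pull.
by rewrite (swpK sepE).
Qed.

Lemma kept_pull e : e \in E -> kept (pull E m) e = kept m e.
Proof.
by move=> eE; rewrite /kept !nth_pull (swp_pred sepE) // (swp_edge sepE) // andbC.
Qed.

(** The prefix of length [k] cuts an exchanged pair only when [k] is an edge of [E]; the bit of [m]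
    at [k.-1] is then replaced by the bit at [k]. Both corrections are added, one on each side, to
    stay clear of truncated subtraction. *)
Lemma newpos_pull_shift k :
  newpos (pull E m) k + (k \in E) && nth false m k.-1
  = newpos m k + (k \in E) && nth false m k.
Proof.
have [_ sepS] := sepP sepE.
elim: k => [|k]; rewrite ?newposS ?nth_pull.
  rewrite !newpos0; case E0: (0 \in E) => //=; by case: (sepP sepE) => /(_ 0 E0).
case: (swpP sepE k) => [k1 k0|kp k0 k1|k0 k1].
- by rewrite k1 (negbTE k0) /=; lia.
- by rewrite k0 (negbTE k1) /=; lia.
- by rewrite (negbTE k0) (negbTE k1) /=; lia.
Qed.

Lemma newpos_pull k : k \notin E -> newpos (pull E m) k = newpos m k.
Proof. by move=> kE; have := newpos_pull_shift k; rewrite (negbTE kE) /=; lia. Qed.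

Lemma newpos_pull_edge e : e \in E -> newpos (pull E m) e = newpos m e.-1 + nth false m e.
Proof.
move=> eE; have [/(_ e eE)/andP[e0 _] _] := sepP sepE.
by have := newpos_pull_shift e; rewrite eE /=; case: e e0 {eE} => //= e _;
  rewrite [newpos m e.+1]newposS; lia.
Qed.

Lemma newpos_pull_kept e : e \in E -> kept m e -> newpos (pull E m) e = newpos m e.
Proof.
move=> eE ke; have [/(_ e eE)/andP[e0 _] _] := sepP sepE.
rewrite (newpos_pull_edge eE); case/andP: (ke) => _ ->.
by rewrite (newpos_pred ke e0) addn1.
Qed.

Lemma mem_kept_edges k : nth false m k -> (newpos m k \in kept_edges m E) = (k \in E) && kept m k.
Proof.
move=> mk; apply/mapP/idP => [[e]|/andP[kE kk]].
  by rewrite mem_filter => /andP[ke eE] /(newpos_inj mk)->; [rewrite eE | case/andP: ke].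
by exists k; rewrite // mem_filter kk.
Qed.

Lemma mem_kept_edgesS k :
  nth false m k -> ((newpos m k).+1 \in kept_edges m E) = (k.+1 \in E) && nth false m k.+1.
Proof.
move=> mk; apply/mapP/idP => [[e]|/andP[kE mk1]].
  rewrite mem_filter => /andP[ke eE].
  have [/(_ e eE)/andP[e0 _] _] := sepP sepE.
  rewrite (newpos_pred ke e0) => -[]; case: e e0 ke eE => // e _ /andP[/= me me1] eE.
  by move=> /(newpos_inj mk me)->; rewrite eE.
by exists k.+1; rewrite ?mem_filter ?kE ?andbT /kept /= ?mk // newposS mk addn1.
Qed.

(** Renumbering intertwines the swap before restriction with the swap after it. At an edge with only
    one surviving end, that end moves by one position but keeps its rank among the survivors, in
    agreement with the absence of the edge from [kept_edges]. *)
Lemma swp_newpos k : nth false m k ->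
  swp (kept_edges m E) (newpos m k) = newpos (pull E m) (swp E k).
Proof.
move=> mk; rewrite /swp mem_kept_edgesS // mem_kept_edges //.
case k1: (k.+1 \in E) => /=.
  rewrite newpos_pull_edge //=; case: (nth false m k.+1); first by rewrite addn1.
  rewrite addn0; case kE: (k \in E); last by rewrite /= andbF.
  by case: (sepP sepE) => _ /(_ k kE); rewrite k1.
case kE: (k \in E) => /=; last by rewrite !andbF newpos_pull ?kE.
have [/(_ k kE)/andP[k0 _] _] := sepP sepE; rewrite k0 andbT /kept mk andbT.
rewrite newpos_pull; last first.
  by apply/negP=> kE1; case: (sepP sepE) => _ /(_ _ kE1); rewrite prednK ?kE.
case: k k0 mk {k1} kE => //= k _ mk kE; rewrite newposS.
by case: (nth false m k); rewrite ?addn1 ?addn0 //= andbF.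
Qed.

(** If [e] and [f] are kept and [e.+1 < f], the positions [e] and [f.-1] both survive and are
    distinct, so a gap remains after renumbering. *)
Lemma sep_kept_edges : sep (count id m) (kept_edges m E).
Proof.
case/andP: (sepE) => srtE /allP bndE; apply/andP; split; last first.
  apply/allP => x /mapP[e]; rewrite mem_filter => /andP[ke eE] -> {x}.
  have /andP[e0 _] := bndE e eE.
  by rewrite (newpos_pred ke e0) /= -(newpos_pred ke e0) newpos_lt_count //; case/andP: ke.
rewrite sorted_map; have := sorted_filter sep_rel_trans (kept m) srtE.
have: all (fun e => kept m e && (0 < e)) [seq e <- E | kept m e].
  by apply/allP=> e; rewrite mem_filter => /andP[-> /bndE/andP[]].
move=> + srtF; elim: [seq _ <- _ | _] srtF => // e [|f F] IH //= /andP[lt_ef pF].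
case/and3P=> /andP[ke e0] /andP[kf f0] allF.
move/(_ pF): IH; rewrite /= kf f0 => /(_ allF) ->; rewrite andbT.
by rewrite (newpos_pred kf f0) ltnS newpos_lt //; [case/andP: ke | lia].
Qed.

End Pull.

(** * Restricting and swapping diagrams *)

Section Diagrams.
Variable L : Type.
Implicit Types (D : diag L) (m : bitseq).

Definition arrow_closed D m :=
  (size m == size D) && all (fun j => nth false m (ptn D j) == nth false m j) (iota 0 (size D)).

Lemma arrow_closedP D m :
  reflect (size m = size D /\ forall j, j < size D -> nth false m (ptn D j) = nth false m j)
          (arrow_closed D m).
Proof.
apply: (iffP andP) => [[/eqP sz /allP H]|[/eqP sz H]]; split=> //.
  by move=> j lt_j; apply/eqP/H; rewrite mem_iota.
by apply/allP => j; rewrite mem_iota /= => /H/eqP.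
Qed.

Lemma wfP D :
  reflect (forall j, j < size D -> [/\ ptn D j < size D, ptn D j != j,
                    ptn D (ptn D j) = j & hd D (ptn D j) != hd D j]) (wf D).
Proof.
apply: (iffP allP) => H j.
  by move=> lt_j; have /H/and4P[? ? /eqP ? ?] : j \in iota 0 (size D) by rewrite mem_iota.
by rewrite mem_iota /= => /H[-> -> -> ->]; rewrite eqxx.
Qed.

Lemma ptnE x0 D j : j < size D -> ptn D j = (nth x0 D j).1.1.
Proof. by move=> lt_j; rewrite /ptn (nth_map x0). Qed.

Lemma hdE x0 D j : j < size D -> hd D j = (nth x0 D j).1.2.
Proof. by move=> lt_j; rewrite /hd (nth_map x0). Qed.

Lemma nth_ep x0 D j : j < size D -> nth x0 D j = ((ptn D j, hd D j), (nth x0 D j).2).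
Proof. by move=> lt_j; rewrite (ptnE x0) // (hdE x0) //; case: (nth _ _ _) => [[]]. Qed.

Lemma arrow_closed_size D m : arrow_closed D m -> size m = size D.
Proof. by case/arrow_closedP. Qed.

Lemma size_restr D m : size m = size D -> size (restr D m) = count id m.
Proof. by move=> sz; rewrite size_map size_mask. Qed.

Lemma nth_restr x0 D m j : size m = size D -> nth false m j ->
  nth x0 (restr D m) (newpos m j) = ((newpos m (ptn D j), hd D j), (nth x0 D j).2).
Proof.
move=> sz mj; have lt_j := mask_lt_size mj; rewrite sz in lt_j.
by rewrite (nth_map x0) ?size_mask ?newpos_lt_count // nth_mask_newpos // (ptnE x0) // (hdE x0).
Qed.

Lemma ptn_restr D m j : size m = size D -> nth false m j ->
  ptn (restr D m) (newpos m j) = newpos m (ptn D j).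
Proof.
case: D => [|x0 D] sz mj; first by move: (mask_lt_size mj); rewrite sz.
by rewrite (ptnE x0) ?nth_restr // size_restr // newpos_lt_count.
Qed.

Lemma hd_restr D m j : size m = size D -> nth false m j ->
  hd (restr D m) (newpos m j) = hd D j.
Proof.
case: D => [|x0 D] sz mj; first by move: (mask_lt_size mj); rewrite sz.
by rewrite (hdE x0) ?nth_restr // size_restr // newpos_lt_count.
Qed.

Lemma arrow_closed_ptn D m j : arrow_closed D m -> nth false m j -> nth false m (ptn D j).
Proof. by case/arrow_closedP=> sz H mj; rewrite H // -sz mask_lt_size. Qed.

Lemma wf_restr D m : wf D -> arrow_closed D m -> wf (restr D m).
Proof.
move=> /wfP wfD clm; have sz := arrow_closed_size clm.
apply/wfP=> p; rewrite size_restr // => /newpos_surj[j mj ->].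
have lt_j : j < size D by rewrite -sz mask_lt_size.
have [lt_p np pp hp] := wfD j lt_j; have mp := arrow_closed_ptn clm mj.
by rewrite !(ptn_restr sz) // !(hd_restr sz) // newpos_lt_count // newpos_eqE // pp.
Qed.

(** Quantifying over the default [x0] avoids asking for an element of [L]; the empty diagram is
    treated apart. *)
Lemma diag_ext D1 D2 : size D1 = size D2 ->
  (forall x0 j, j < size D1 -> nth x0 D1 j = nth x0 D2 j) -> D1 = D2.
Proof.
case: D1 => [/esym/size0nil->|x0 D1] // sz H.
by apply: (eq_from_nth (x0 := x0)) => // j; apply: H.
Qed.

Lemma size_swap D E : size (swap D E) = size D.
Proof. by case: D => // x D; rewrite /swap size_mkseq. Qed.

Section SwapDiagram.
Variables (D : diag L) (E : seq nat).
Hypothesis sepE : sep (size D) E.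

Lemma nth_swap x0 j : j < size D ->
  nth x0 (swap D E) (swp E j) = ((swp E (ptn D j), hd D j), (nth x0 D j).2).
Proof.
case: D sepE => // x D' sepD lt_j.
rewrite nth_mkseq ?(swp_ltN sepD) // (swpK sepD) (set_nth_default x0) //.
by rewrite (ptnE x0) // (hdE x0).
Qed.

Lemma ptn_swap j : j < size D -> ptn (swap D E) (swp E j) = swp E (ptn D j).
Proof.
case D_: D => [|x0 D'] //; rewrite -D_ => lt_j.
by rewrite (ptnE x0) ?nth_swap // size_swap (swp_ltN sepE).
Qed.

Lemma hd_swap j : j < size D -> hd (swap D E) (swp E j) = hd D j.
Proof.
case D_: D => [|x0 D'] //; rewrite -D_ => lt_j.
by rewrite (hdE x0) ?nth_swap // size_swap (swp_ltN sepE).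
Qed.

Lemma wf_swap : wf D -> wf (swap D E).
Proof.
move=> /wfP wfD; apply/wfP=> p; rewrite size_swap => lt_p.
rewrite -(swpK sepE p); have : swp E p < size D by rewrite (swp_ltN sepE).
move: (swp E p) => {p lt_p} j lt_j; have [lt_p np pp hp] := wfD j lt_j.
rewrite !ptn_swap // !hd_swap // (swp_ltN sepE) pp lt_p hp; split=> //.
by apply: contra np => /eqP/(can_inj (swpK sepE))->.
Qed.

Lemma arrow_closed_pull m : arrow_closed D m -> arrow_closed (swap D E) (pull E m).
Proof.
move=> /arrow_closedP[sz H]; have sepm : sep (size m) E by rewrite sz.
apply/arrow_closedP; rewrite size_pull size_swap; split=> // p lt_p.
rewrite -(swpK sepE p); have : swp E p < size D by rewrite (swp_ltN sepE).
by move: (swp E p) => j lt_j; rewrite ptn_swap // !nth_pull // !(swpK sepE) H.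
Qed.

Lemma count_pull m : sep (size m) E -> count id (pull E m) = count id m.
Proof.
move=> sepm; rewrite -!newpos_size size_pull newpos_pull //.
by apply/negP=> sE; case: (sepP sepm) => /(_ _ sE); rewrite ltnn andbF.
Qed.

End SwapDiagram.

(** Restriction turns a swap into the swap along the surviving edges. This identity yields the
    reversal of subgerms, the equality of the two subdiagrams when no edge survives, and the
    exchange of arrows in the second move. *)
Lemma restr_swap D E m : sep (size D) E -> arrow_closed D m ->
  restr (swap D E) (pull E m) = swap (restr D m) (kept_edges m E).
Proof.
move=> sepE clm; have sz := arrow_closed_size clm; have sepm : sep (size m) E by rewrite sz.
have szp : size (pull E m) = size (swap D E) by rewrite size_pull size_swap.
have szr := size_restr sz.
apply: diag_ext; first by rewrite size_swap (size_restr szp) szr count_pull.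
move=> x0 p; rewrite size_restr // => /newpos_surj[k' + ->].
(* The survivors of the pulled mask are exactly the [swp E k] with [k] surviving in [m]. *)
rewrite nth_pull // -(swpK sepE k'); move: (swp E k') => k; rewrite (swpK sepE) => mk.
have lt_k : k < size D by rewrite -sz mask_lt_size.
rewrite nth_restr ?nth_pull // ?(swpK sepE) // ptn_swap // hd_swap // nth_swap //=.
rewrite -(swp_newpos sepm mk) nth_swap ?szr ?newpos_lt_count ?sep_kept_edges //.
by rewrite ptn_restr // hd_restr // nth_restr // swp_newpos // (arrow_closed_ptn clm).
Qed.

Lemma swapK D E : sep (size D) E -> swap (swap D E) E = D.
Proof.
move=> sepE.
apply: diag_ext; rewrite ?size_swap // => x0 p lt_p.
have lt_s : swp E p < size D by rewrite (swp_ltN sepE).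
have sepE' : sep (size (swap D E)) E by rewrite size_swap.
rewrite -{1}(swpK sepE p) nth_swap ?size_swap //.
by rewrite ptn_swap // hd_swap // nth_swap // (swpK sepE) -nth_ep.
Qed.

Lemma swap_nil D : swap D [::] = D.
Proof.
apply: diag_ext; rewrite ?size_swap // => x0 p lt_p.
have swp0 j : swp [::] j = j by rewrite /swp /= andbF.
by rewrite -[p in LHS]swp0 nth_swap // swp0 -nth_ep.
Qed.

Lemma restr_restr D n m : size n = size D -> size m = size D ->
  (forall j, nth false m j -> nth false n j) ->
  restr (restr D n) (mask n m) = restr D m.
Proof.
move=> szn szm le_mn.
have szmn : size (mask n m) = size (restr D n) by rewrite size_restr // size_mask // szn.
have eqs : size m = size n by rewrite szn.
apply: diag_ext; first by rewrite (size_restr szmn) (size_restr szm) count_id_mask.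
move=> x0 p; rewrite (size_restr szmn) ?(size_restr szm) count_id_mask // => /newpos_surj[k mk ->].
rewrite -[in LHS](newpos_mask k eqs le_mn).
have nk := le_mn k mk.
rewrite nth_restr ?nth_mask_newpos // ptn_restr // hd_restr // newpos_mask //.
by rewrite !nth_restr.
Qed.

Lemma arrow_closed_mask D n m :
  arrow_closed D n -> arrow_closed D m -> arrow_closed (restr D n) (mask n m).
Proof.
move=> cln clm; have /arrow_closedP[szn Hn] := cln; have /arrow_closedP[szm Hm] := clm.
apply/arrow_closedP; rewrite size_restr // size_mask ?szn //; split=> // p /newpos_surj[j nj ->].
rewrite ptn_restr // !nth_mask_newpos ?(arrow_closed_ptn cln) // Hm //.
by rewrite -szn mask_lt_size.
Qed.

End Diagrams.

(** * Arrow subsets as invariant masks *)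

Lemma bseqsS n : bseqs n.+1 = map (cons true) (bseqs n) ++ map (cons false) (bseqs n).
Proof. by rewrite /= cats0. Qed.

Lemma mem_bseqs n s : (s \in bseqs n) = (size s == n).
Proof.
elim: n s => [|n IH] [|b s] //; rewrite bseqsS mem_cat.
  by apply/negbTE/negP => /orP[] /mapP[].
have in_cons c : (b :: s \in map (cons c) (bseqs n)) = (b == c) && (s \in bseqs n).
  apply/mapP/andP => [[t tn [-> ->]]|[/eqP-> sn]]; first by rewrite eqxx.
  by exists s.
by rewrite !in_cons eqSS -IH; case: b {in_cons}; rewrite ?orbF.
Qed.

Lemma uniq_bseqs n : uniq (bseqs n).
Proof.
elim: n => // n IH; rewrite bseqsS cat_uniq !map_inj_uniq ?IH ?andbT //=; try by move=> x y [].
by apply/hasPn => _ /mapP[s _ ->]; apply/mapP => -[].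
Qed.

(** Turns the counting definition of [arrow_index] into an index in a list, for which [nth_index]
    and [index_uniq] are available. *)
Lemma index_filter_iota (P : pred nat) n a :
  a < n -> P a -> index a [seq i <- iota 0 n | P i] = count P (iota 0 a).
Proof.
move=> lt_an Pa; rewrite -(subnKC lt_an) addSnnS iotaD filter_cat index_cat mem_filter mem_iota.
by rewrite ltnn andbF /= add0n Pa /= eqxx addn0 size_filter.
Qed.

Section Openers.
Variables (L : Type) (D : diag L).
Hypothesis wfD : wf D.

(** The names of the arrows, in the order in which [arrow_index] numbers them. *)
Definition openers := [seq i <- iota 0 (size D) | i < ptn D i].
Definition vmasks := [seq m <- bseqs (size D) | arrow_closed D m].

Lemma mem_openers j : (j \in openers) = (j < ptn D j) && (j < size D).
Proof. by rewrite mem_filter mem_iota. Qed.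

Lemma aid_opener j : j < size D -> aid D j \in openers.
Proof.
move=> lt_j; have [lt_p np pp _] := wfP _ wfD _ lt_j.
rewrite mem_openers /aid; case: (ltnP j (ptn D j)) => [lt_jp|]; first by rewrite lt_jp.
by rewrite pp leq_eqVlt (negbTE np) /= => ->.
Qed.

Lemma aid_id j : j \in openers -> aid D j = j.
Proof. by rewrite mem_openers => /andP[lt_jp _]; apply/minn_idPl/ltnW. Qed.

Lemma arrow_indexE j : j < size D -> arrow_index D j = index (aid D j) openers.
Proof.
by move=> /aid_opener; rewrite mem_openers => /andP[? ?]; rewrite index_filter_iota.
Qed.

Lemma aid_inj_arrow j k : j < size D -> k < size D ->
  (arrow_index D j == arrow_index D k) = (aid D j == aid D k).
Proof.
move=> lt_j lt_k; rewrite !arrow_indexE //; apply/eqP/eqP => [|->//].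
by move/(congr1 (nth 0 openers)); rewrite !nth_index // aid_opener.
Qed.

Lemma uniq_openers : uniq openers.
Proof. by rewrite filter_uniq // iota_uniq. Qed.

Lemma perm_openers : perm_eq (openers ++ map (ptn D) openers) (iota 0 (size D)).
Proof.
apply: uniq_perm; rewrite ?iota_uniq //.
  rewrite cat_uniq uniq_openers /= map_inj_in_uniq ?uniq_openers ?andbT.
    apply/hasPn => x /mapP[j]; rewrite !mem_openers => /andP[lt_jp lt_j] -> {x}.
    by have [_ _ -> _] := wfP _ wfD _ lt_j; rewrite ltnNge ltnW.
  move=> j k; rewrite !mem_openers => /andP[_ lt_j] /andP[_ lt_k] /(congr1 (ptn D)).
  by have [_ _ -> _] := wfP _ wfD _ lt_j; have [_ _ -> _] := wfP _ wfD _ lt_k.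
move=> j; rewrite mem_cat mem_iota /= mem_openers.
apply/orP/idP => [[/andP[]//|/mapP[k]]|lt_j].
  by rewrite mem_openers => /andP[_ lt_k] ->; case: (wfP _ wfD _ lt_k).
have [lt_p np pp _] := wfP _ wfD _ lt_j.
rewrite lt_j andbT; case: (ltnP j (ptn D j)) => [|le]; first by left.
by right; rewrite -{1}pp map_f // mem_openers lt_p pp ltn_neqAle np le.
Qed.

Lemma size_openers : size openers = narrows D.
Proof.
have /perm_size := perm_openers; rewrite size_cat size_map size_iota addnn /narrows => <-.
by rewrite doubleK.
Qed.

Lemma size_amask tau : size (amask D tau) = size D.
Proof. by rewrite size_map size_iota. Qed.

Lemma nth_amask tau j : j < size D ->
  nth false (amask D tau) j = nth false tau (arrow_index D j).
Proof. by move=> lt_j; rewrite (nth_map 0) ?size_iota // nth_iota. Qed.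

Lemma aid_ptn j : j < size D -> aid D (ptn D j) = aid D j.
Proof. by move=> lt_j; have [_ _ pp _] := wfP _ wfD _ lt_j; rewrite /aid pp minnC. Qed.

Lemma arrow_index_ptn j : j < size D -> arrow_index D (ptn D j) = arrow_index D j.
Proof. by move=> lt_j; rewrite /arrow_index aid_ptn. Qed.

Lemma arrow_closed_amask tau : arrow_closed D (amask D tau).
Proof.
apply/arrow_closedP; split=> [|j lt_j]; first exact: size_amask.
have [lt_p _ _ _] := wfP _ wfD _ lt_j.
by rewrite !nth_amask // arrow_index_ptn.
Qed.

Lemma amask_openers tau : size tau = narrows D ->
  map (nth false (amask D tau)) openers = tau.
Proof.
move=> sz; apply: (eq_from_nth (x0 := false)); rewrite size_map size_openers //.
move=> i lt_i; rewrite (nth_map 0) ?size_openers //.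
have : nth 0 openers i \in openers by rewrite mem_nth ?size_openers.
move=> op; have lt_n : nth 0 openers i < size D by move: op; rewrite mem_openers => /andP[].
by rewrite nth_amask // arrow_indexE // aid_id // index_uniq ?uniq_openers ?size_openers.
Qed.

Lemma openers_amask m : arrow_closed D m -> amask D (map (nth false m) openers) = m.
Proof.
move=> /arrow_closedP[sz H]; apply: (eq_from_nth (x0 := false)); rewrite size_amask // => j lt_j.
rewrite nth_amask // arrow_indexE // (nth_map 0) ?index_mem ?aid_opener //.
by rewrite nth_index ?aid_opener // /aid; case: ltnP => // _; rewrite H.
Qed.

Lemma mem_vmasks m : (m \in vmasks) = arrow_closed D m.
Proof.
rewrite mem_filter mem_bseqs; apply: andb_idr => /arrow_closedP[-> _]; exact: eqxx.
Qed.

Lemma uniq_vmasks : uniq vmasks.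
Proof. by rewrite filter_uniq // uniq_bseqs. Qed.

(** The inverse of [amask D] reads a closed mask at the openers. Sums over bit strings indexed by
    arrows thereby become sums over closed masks. *)
Lemma perm_amask : perm_eq [seq amask D t | t <- bseqs (narrows D)] vmasks.
Proof.
apply: uniq_perm; rewrite ?uniq_vmasks //.
  rewrite map_inj_in_uniq ?uniq_bseqs // => s t; rewrite !mem_bseqs => /eqP ss /eqP st st_.
  by rewrite -(amask_openers ss) st_ amask_openers.
move=> m; rewrite mem_vmasks; apply/mapP/idP => [[t _ ->]|clm]; first exact: arrow_closed_amask.
exists (map (nth false m) openers); last by rewrite openers_amask.
by rewrite mem_bseqs size_map size_openers.
Qed.

(** Each dropped arrow accounts for two positions, its opener and the partner of that opener. *)
Lemma count_amask tau : size tau = narrows D ->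
  count negb (amask D tau) = (count negb tau).*2.
Proof.
move=> sz; have -> : count negb (amask D tau)
    = count (fun j => ~~ nth false (amask D tau) j) (iota 0 (size D)).
  rewrite -{1}[amask D tau](mkseq_nth false) /mkseq count_map size_amask.
  exact: eq_count.
rewrite -(permP perm_openers) count_cat count_map.
have <- : count negb tau = count (fun j => ~~ nth false (amask D tau) j) openers.
  by rewrite -{1}(amask_openers sz) count_map; apply: eq_count.
rewrite -addnn; congr (_ + _).
rewrite -[in RHS](amask_openers sz) [RHS]count_map.
apply: eq_in_count => j; rewrite mem_openers => /andP[_ lt_j] /=.
by have /arrow_closedP[_ ->] := arrow_closed_amask tau.
Qed.

End Openers.

(** * Signs as masks, and the coefficients of [S_d] *)

Local Open Scope ring_scope.

Definition mask_sign (m : bitseq) : rat := (-1) ^+ (count negb m)./2.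
(* The product of the signs of the arrows of [G], each having two endpoints. *)
Definition dsign (G : gdiag) : rat := mask_sign (map snd G).
(** For well-formed arguments, the coefficient of [G] in [S_d A]; see [sum_signD]. *)
Definition weight (A : adiag) (G : gdiag) : rat := if forgetD G == A then dsign G else 0.

Lemma sum_delta (T : eqType) (r : seq T) (y : T) (F : T -> rat) : uniq r ->
  \sum_(x <- r) F x * (x == y)%:R = if y \in r then F y else 0.
Proof.
move=> ur; transitivity (\sum_(x <- r | x == y) F x).
  by rewrite [RHS]big_mkcond; apply: eq_bigr => x _; case: eqP; rewrite (mulr1, mulr0).
case: ifP => yr; first by rewrite (big_rem y) //= eqxx big1_seq ?addr0 // => x /andP[/eqP->];
  rewrite mem_rem_uniqF.
by rewrite big1_seq // => x /andP[/eqP->]; rewrite yr.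
Qed.

Lemma forget_eq (G : gdiag) (A : adiag) : (forgetD G == A) = (map fst G == map fst A).
Proof.
apply/eqP/eqP => [<-|]; first by rewrite -map_comp.
by elim: G A => [|x G IH] [|[y []] A] //= [-> /IH->].
Qed.

Lemma size_forget (G : gdiag) : size (forgetD G) = size G.
Proof. exact: size_map. Qed.

Lemma fst_signD (A : adiag) s : map fst (signD A s) = map fst A.
Proof.
have {2}-> : A = unzip2 (zip (iota 0 (size A)) A) by rewrite unzip2_zip ?size_iota.
by rewrite -!map_comp.
Qed.

Lemma snd_signD (A : adiag) s : wf A -> size s = narrows A -> map snd (signD A s) = amask A s.
Proof.
move=> wfA sz; rewrite /amask /signD.
have {2}-> : iota 0 (size A) = unzip1 (zip (iota 0 (size A)) A).
  by rewrite unzip1_zip ?size_iota.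
rewrite -!map_comp; apply/eq_in_map => -[j x] /(map_f fst) /=.
rewrite -/(unzip1 _) unzip1_zip ?size_iota // mem_iota /= => lt_j.
(* [signD] reads signs with default [true] and [amask] with default [false]; the arrow index is in
   range, so both read the same bit. *)
by apply: set_nth_default; rewrite sz -size_openers // arrow_indexE // index_mem aid_opener.
Qed.

Lemma signD_eq (A : adiag) s (H : gdiag) : wf A -> size s = narrows A ->
  (signD A s == H) = (forgetD H == A) && (amask A s == map snd H).
Proof.
move=> wfA sz; rewrite forget_eq; apply/eqP/andP => [<-|[/eqP fH /eqP sH]].
  by rewrite fst_signD snd_signD.
rewrite -(zip_unzip H) -(zip_unzip (signD A s)) /unzip1 /unzip2.
by rewrite fst_signD snd_signD // fH sH.
Qed.

Lemma ptn_forget (G : gdiag) j : ptn (forgetD G) j = ptn G j.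
Proof. by rewrite /ptn -map_comp. Qed.

Lemma hd_forget (G : gdiag) j : hd (forgetD G) j = hd G j.
Proof. by rewrite /hd -map_comp. Qed.

Lemma wf_gdP (G : gdiag) :
  reflect (wf G /\ forall j, (j < size G)%N -> sgn G (ptn G j) = sgn G j) (wf_gd G).
Proof.
apply: (iffP andP) => -[wfG H]; split=> //.
  by move=> j lt_j; apply/eqP/(allP H); rewrite mem_iota.
by apply/allP => j; rewrite mem_iota /= => /H/eqP.
Qed.

(** Both ends of an arrow carry its sign, so the list of signs is itself a closed mask, and the
    bijection with closed masks serves for sign assignments as well as for arrow subsets. *)
Lemma arrow_closed_signs (G : gdiag) : wf_gd G -> arrow_closed G (map snd G).
Proof.
case/wf_gdP=> /wfP wfG H; apply/arrow_closedP; rewrite size_map; split=> // j lt_j.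
have [lt_p _ _ _] := wfG j lt_j.
rewrite !(set_nth_default true false) ?size_map //; exact: H.
Qed.

Lemma arrow_closed_forget (G : gdiag) m : arrow_closed (forgetD G) m = arrow_closed G m.
Proof.
rewrite /arrow_closed size_forget; congr andb; apply: eq_all => j; by rewrite ptn_forget.
Qed.

(** At most one signing of [A] is [H]: the one read off from the signs of [H], available exactly
    when [H] forgets to [A]. *)
Lemma sum_signD (A : adiag) (H : gdiag) : wf A -> wf_gd H ->
  \sum_(s <- bseqs (narrows A)) sgnr s * (signD A s == H)%:R = weight A H.
Proof.
move=> wfA wfH; transitivity (\sum_(m <- [seq amask A t | t <- bseqs (narrows A)])
    mask_sign m * ((forgetD H == A) && (m == map snd H))%:R).
  rewrite big_map; apply: eq_big_seq => s; rewrite mem_bseqs => /eqP sz.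
  by rewrite signD_eq // /mask_sign count_amask // doubleK.
rewrite (perm_big _ (perm_amask wfA)) /weight; case: eqP => /= [fH|_]; last first.
  by rewrite big1 // => m _; rewrite mulr0.
by rewrite sum_delta ?uniq_vmasks // mem_vmasks -fH arrow_closed_forget arrow_closed_signs.
Qed.

Local Close Scope ring_scope.

(** * Gauss diagrams under restrictions and swaps *)

Lemma newpos_gap m e f : kept m e -> kept m f -> e.+1 < f -> (newpos m e).+1 < newpos m f.
Proof.
move=> /andP[_ me] kf lt_ef; have f0 : 0 < f by lia.
by rewrite (newpos_pred kf f0) ltnS newpos_lt //; lia.
Qed.

Lemma forget_restr G m : forgetD (restr G m) = restr (forgetD G) m.
Proof. by rewrite /forgetD /restr -map_mask -!map_comp. Qed.

Lemma forget_swap G E : forgetD (swap G E) = swap (forgetD G) E.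
Proof.
case: G => // x0 G; rewrite /forgetD /swap [size (map _ _)]size_map /mkseq -map_comp.
apply: eq_map => j; rewrite /comp -/(map _ (x0 :: G)).
have [lt_j|ge_j] := ltnP (swp E j) (size (x0 :: G)); first by rewrite (nth_map x0).
by rewrite !nth_default // size_map.
Qed.

Lemma sgnE (x0 : ep bool) (G : gdiag) j : j < size G -> sgn G j = (nth x0 G j).2.
Proof. by move=> lt_j; rewrite /sgn (nth_map x0). Qed.

Lemma sgn_restr (G : gdiag) m j : size m = size G -> nth false m j ->
  sgn (restr G m) (newpos m j) = sgn G j.
Proof.
move=> sz mj; have lt_j := mask_lt_size mj; rewrite sz in lt_j.
rewrite !(sgnE (0, false, true)) ?nth_restr ?size_restr //; exact: newpos_lt_count.
Qed.

Lemma sgn_swap (G : gdiag) E j : sep (size G) E -> j < size G ->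
  sgn (swap G E) (swp E j) = sgn G j.
Proof.
move=> sepE lt_j.
by rewrite !(sgnE (0, false, true)) ?nth_swap // size_swap (swp_ltN sepE).
Qed.

Lemma wf_gd_restr (G : gdiag) m : wf_gd G -> arrow_closed G m -> wf_gd (restr G m).
Proof.
case/wf_gdP=> wfG sG cl; have sz := arrow_closed_size cl.
apply/wf_gdP; split; first exact: wf_restr.
move=> p; rewrite size_restr // => /newpos_surj[j mj ->].
rewrite ptn_restr // !sgn_restr ?sG ?(arrow_closed_ptn cl) // -sz; exact: mask_lt_size.
Qed.

Lemma wf_gd_swap (G : gdiag) E : sep (size G) E -> wf_gd G -> wf_gd (swap G E).
Proof.
move=> sepE /wf_gdP[wfG sG]; apply/wf_gdP; split; first exact: wf_swap.
move=> p; rewrite size_swap => lt_p; rewrite -(swpK sepE p).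
have : swp E p < size G by rewrite (swp_ltN sepE).
move: (swp E p) => {p lt_p} j lt_j; have [lt_q _ _ _] := wfP _ wfG _ lt_j.
by rewrite ptn_swap // !sgn_swap // sG.
Qed.

Lemma aid_eq (L : Type) (D : diag L) j k : wf D -> j < size D -> k < size D ->
  (aid D j == aid D k) = (j == k) || (j == ptn D k).
Proof.
move=> wfD lt_j lt_k; apply/eqP/orP => [|[/eqP->//|/eqP->]]; last by rewrite aid_ptn.
have [_ _ pj _] := wfP _ wfD _ lt_j; have [_ _ pk _] := wfP _ wfD _ lt_k.
rewrite /aid; case: ltnP => _; case: ltnP => _ E.
- by left; rewrite E.
- by right; rewrite E.
- by right; rewrite -E pj.
- by left; rewrite -pj E pk.
Qed.

Section RestrictedEdges.
Variables (G : gdiag) (m : bitseq).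
Hypothesis cl : arrow_closed G m.
Let sz := arrow_closed_size cl.

Lemma aid_restr j : nth false m j -> aid (restr G m) (newpos m j) = newpos m (aid G j).
Proof.
move=> mj; rewrite /aid ptn_restr //; case: (leqP j (ptn G j)) => le_jp.
  by apply/minn_idPl; apply: newpos_mono.
by apply/minn_idPr; apply: newpos_mono; apply: ltnW.
Qed.

Lemma aid_kept j : nth false m j -> nth false m (aid G j).
Proof. by move=> mj; rewrite /aid; case: ltnP => // _; apply: arrow_closed_ptn cl mj. Qed.

Lemma interlace_restr x y : nth false m x -> nth false m y ->
  interlace (restr G m) (newpos m x) (newpos m y) = interlace G x y.
Proof.
move=> mx my; have [mp mq] := (arrow_closed_ptn cl mx, arrow_closed_ptn cl my).
rewrite /interlace !ptn_restr //.
have -> : minn (newpos m x) (newpos m (ptn G x)) = newpos m (minn x (ptn G x)).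
  by rewrite /minn newpos_ltE // -fun_if.
have -> : maxn (newpos m x) (newpos m (ptn G x)) = newpos m (maxn x (ptn G x)).
  by rewrite /maxn newpos_ltE // -fun_if.
have m1 : nth false m (minn x (ptn G x)) by rewrite /minn; case: ifP.
have m2 : nth false m (maxn x (ptn G x)) by rewrite /maxn; case: ifP.
by rewrite !newpos_ltE.
Qed.

Lemma up_restr e : 0 < e -> kept m e -> up (restr G m) (newpos m e) = up G e.
Proof.
move=> e0 ke; rewrite /up {1}(newpos_pred ke e0) /=.
by case/andP: ke => m1 m2; rewrite !hd_restr.
Qed.

Lemma weps_restr e : 0 < e -> kept m e -> weps (restr G m) (newpos m e) = weps G e.
Proof.
move=> e0 ke; rewrite /weps up_restr // (newpos_pred ke e0) /= -(newpos_pred ke e0).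
by case/andP: ke => m1 m2; rewrite interlace_restr // !sgn_restr.
Qed.

End RestrictedEdges.

Definition ends (D : gdiag) e := (aid D e.-1, aid D e).

Lemma size_undup_map (T U : eqType) (f : T -> U) s :
  {in s &, injective f} -> size (undup (map f s)) = size (undup s).
Proof.
elim: s => //= x s IH injf.
have injs : {in s &, injective f}.
  by move=> y z ys zs; apply: injf; rewrite inE (ys, zs) orbT.
suff -> : (f x \in map f s) = (x \in s) by case: ifP => _ /=; rewrite IH.
apply/mapP/idP => [[y ys fxy]|xs]; last by exists x.
by rewrite (injf x y) // inE ?eqxx ?ys ?orbT.
Qed.

Lemma r3_sep (G : gdiag) e1 e2 e3 : r3_allowed G e1 e2 e3 -> sep (size G) [:: e1; e2; e3].
Proof. by case=> -[a b c d] _; rewrite /sep /= b c a d /=; lia. Qed.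

(** Renumbering is strictly increasing on survivors, so order, crossings, heads, signs and the
    coincidences among the arrows at the three edges are unaffected by the removal of other
    arrows. *)
Lemma r3_restr (G : gdiag) m e1 e2 e3 : arrow_closed G m ->
  all (kept m) [:: e1; e2; e3] -> r3_allowed G e1 e2 e3 ->
  r3_allowed (restr G m) (newpos m e1) (newpos m e2) (newpos m e3).
Proof.
move=> cl /= /and4P[k1 k2 k3 _] [[a b c d] [[n1 n2 n3 n4 [p12 p13 p23]] [w u]]].
cbn [fst snd] in n1, n2, n3, n4.
have sz := arrow_closed_size cl.
have b0 : 0 < e2 := ltn_trans (ltn0Sn _) b.
have c0 : 0 < e3 := ltn_trans (ltn0Sn _) c.
have mk e : kept m e -> 0 < e -> nth false m (aid G e.-1) /\ nth false m (aid G e).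
  by case/andP=> m1 m2 _; split; apply: aid_kept.
have aE e : kept m e -> 0 < e ->
    aid (restr G m) (newpos m e).-1 = newpos m (aid G e.-1) /\
    aid (restr G m) (newpos m e) = newpos m (aid G e).
  move=> ke e0; rewrite {1}(newpos_pred ke e0) /=.
  by case/andP: ke => m1 m2; rewrite !aid_restr.
have [m1 m1'] := mk _ k1 a; have [m2 m2'] := mk _ k2 b0; have [m3 m3'] := mk _ k3 c0.
have [E1 E1'] := aE _ k1 a; have [E2 E2'] := aE _ k2 b0; have [E3 E3'] := aE _ k3 c0.
split; first split; rewrite ?newpos_gap //.
- by rewrite (newpos_pred k1 a).
- by rewrite size_restr // newpos_lt_count //; case/andP: k3.
split; last by rewrite !weps_restr // !up_restr.
rewrite /same_pair in p12 p13 p23 *; cbn [fst snd] in p12, p13, p23 |- *.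
rewrite E1 E1' E2 E2' E3 E3' !newpos_eqE //.
split=> //; try by move/newpos_inj; auto.
(* Injectivity of [newpos m] on the kept arrows preserves the number of distinct ones. *)
rewrite -n4 -[RHS](size_undup_map (f := newpos m)) //.
move=> x y; rewrite !inE => xs ys; apply: newpos_inj.
- by case/or4P: xs => [/eqP->|/eqP->|/eqP->|/or3P[] /eqP->].
- by case/or4P: ys => [/eqP->|/eqP->|/eqP->|/or3P[] /eqP->].
Qed.

(** Since [p] avoids both ends of the edge, its side of [e] decides the minimum and the maximum.
    What remains depends only on the sides of [p] and [q] and on their mutual order. *)
Lemma crossingE (e p q : nat) : 0 < e -> p <> e.-1 -> p <> e -> q <> e.-1 -> q <> e ->
  ((minn e.-1 p < e < maxn e.-1 p) != (minn e.-1 p < q < maxn e.-1 p))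
  = (~~ (p < e) != if p < e then (p < q) && (q < e) else ~~ (q < e) && (q < p)).
Proof.
case: e => // e _ /= pe pe1 qe qe1; case: (ltnP p e.+1) => le_pe /=.
  have lt_pe : p < e by lia.
  rewrite (minn_idPr (ltnW lt_pe)) (maxn_idPl (ltnW lt_pe)).
  have -> : (e.+1 < e) = false by lia.
  rewrite andbF.
  by congr (_ != (_ && _)); lia.
have lt_ep : e < p by lia.
rewrite (minn_idPl (ltnW lt_ep)) (maxn_idPr (ltnW lt_ep)) ltnSn /=.
by congr (_ != _); [lia | congr (_ && _); lia].
Qed.

(* Two chords with ends at [e.-1, p] and [e, q] interlace iff the chords with
   ends [e.-1, q'] and [e, p'] do not, when [p', q'] are placed as [p, q] are. *)
Lemma crossing_toggle (e p q p' q' : nat) :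
  0 < e -> p <> e.-1 -> p <> e -> q <> e.-1 -> q <> e -> p <> q ->
  p' <> e.-1 -> p' <> e -> q' <> e.-1 -> q' <> e -> p' <> q' ->
  (p' < e) = (p < e) -> (q' < e) = (q < e) -> (p' < q') = (p < q) ->
  ((minn e.-1 q' < e < maxn e.-1 q') != (minn e.-1 q' < p' < maxn e.-1 q'))
  = ~~ ((minn e.-1 p < e < maxn e.-1 p) != (minn e.-1 p < q < maxn e.-1 p)).
Proof.
move=> e0 pe1 pe qe1 qe npq p'e1 p'e q'e1 q'e np'q' ltp ltq ltpq.
rewrite !crossingE // ltp ltq ltpq.
have -> : (q' < p') = ~~ (p < q) by rewrite -ltpq; clear -np'q'; lia.
have -> : (q < p) = ~~ (p < q) by clear -npq; lia.
case: (ltnP p e) => pe_; case: (ltnP q e) => qe_ /=; first by case: (p < q).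
- by rewrite (leq_trans pe_ qe_).
- by rewrite ltnNge (ltnW (leq_trans qe_ pe_)).
- by case: (p < q).
Qed.

Section SwappedEdges.
Variables (G : gdiag) (e1 e2 e3 : nat).
Hypotheses (wfG : wf G) (r3G : r3_allowed G e1 e2 e3).
Let E := [:: e1; e2; e3].

Lemma r3_edge e : e \in E -> [/\ 0 < e, e.-1 < size G & e < size G].
Proof.
have [/(_ e) H _] := sepP (r3_sep r3G) => /H /andP[e0 lt_e]; split=> //.
by rewrite prednK // ltnW.
Qed.

Lemma r3_ends e : e \in E -> aid G e.-1 != aid G e.
Proof.
case: r3G => _ [[/= /eqP n1 /eqP n2 /eqP n3 _ _] _].
by rewrite !inE => /or3P[] /eqP->.
Qed.

Lemma r3_ptn e : e \in E -> ptn G e.-1 != e /\ ptn G e != e.-1.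
Proof.
move=> eE; have [e0 lt1 lt2] := r3_edge eE; have := r3_ends eE.
rewrite aid_eq // negb_or => /andP[_ ne1]; split; last by rewrite eq_sym.
by apply: contraNneq ne1 => pe; rewrite -{2}pe; have [_ _ -> _] := wfP _ wfG _ lt1.
Qed.

Lemma same_pairC p q : same_pair p q = same_pair q p.
Proof.
rewrite /same_pair !(eq_sym q.1) !(eq_sym q.2); congr orb; exact: andbC.
Qed.

Lemma r3_not_same_pair e f : e \in E -> f \in E -> e != f ->
  ~~ same_pair (ends G e) (ends G f).
Proof.
case: r3G => _ [[_ _ _ _ [p12 p13 p23]] _].
rewrite !inE => /or3P[] /eqP-> /or3P[] /eqP->; rewrite ?eqxx // => _ //;
  by rewrite same_pairC.
Qed.

(* No two edges of the move join the same two arrows. *)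
Lemma r3_not_parallel e : e \in E -> swp E (ptn G e.-1) != ptn G e.
Proof.
move=> eE; have [e0 lt1 lt2] := r3_edge eE; have [pe1 pe] := r3_ptn eE.
have [lp np pp _] := wfP _ wfG _ lt1; have [lq nq pq _] := wfP _ wfG _ lt2.
have sepE := r3_sep r3G.
have no f : f \in E -> f != e ->
   ~~ (((f.-1 == ptn G e.-1) && (f == ptn G e)) || ((f == ptn G e.-1) && (f.-1 == ptn G e))).
  move=> fE fe; apply: contra (r3_not_same_pair eE fE _); last by rewrite eq_sym.
  case/orP=> /andP[/eqP a /eqP b]; rewrite /same_pair /ends /=.
    by rewrite a b !aid_ptn // !eqxx.
  by rewrite b a !aid_ptn // !eqxx orbT.
case: (swpP sepE (ptn G e.-1)) => [k1 k0|k0 kE k1|k0 k1].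
- apply: contraNneq (no _ k1 _) => [<-|]; first by rewrite /= !eqxx.
  by apply: contraNneq np => pe'; rewrite -{2}pe' eqxx.
- apply: contraNneq (no _ kE _) => [<-|]; first by rewrite !eqxx orbT.
  exact: pe1.
- apply/eqP => epq; have : e = e.-1 by rewrite -{1}pq -epq pp.
  by lia.
Qed.

(** The swap exchanges the near ends of the two arrows at [e], while their far ends keep their sides
    of [e] and, by [r3_not_parallel], their mutual order. *)
Lemma interlace_swap e : e \in E ->
  interlace (swap G E) e.-1 e = ~~ interlace G e.-1 e.
Proof.
move=> eE; have [e0 lt1 lt2] := r3_edge eE; have [/eqP pe1 /eqP pe] := r3_ptn eE.
have [lp /eqP np pp _] := wfP _ wfG _ lt1; have [lq /eqP nq pq _] := wfP _ wfG _ lt2.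
have sepE := r3_sep r3G; have /eqP npar := r3_not_parallel eE.
have se := swp_edge sepE eE; have se1 := swp_pred sepE eE.
have pE1 : ptn (swap G E) e.-1 = swp E (ptn G e) by rewrite -se ptn_swap.
have pE : ptn (swap G E) e = swp E (ptn G e.-1) by rewrite -{1}se1 ptn_swap.
(* Other positions may move, but never across the edge [e]. *)
have away k : k <> e.-1 -> k <> e ->
    [/\ swp E k <> e.-1, swp E k <> e & (swp E k < e) = (k < e)].
  move=> ke1 ke; split; try by [rewrite -se => /(can_inj (swpK sepE))|
    rewrite -{1}se1 => /(can_inj (swpK sepE))].
  have := @swp_lt _ _ sepE k e.-1; rewrite se1 => ->; first by lia.
  by rewrite -se => /(can_inj (swpK sepE)).
have [p1 p2 p3] := away _ np pe1; have [q1 q2 q3] := away _ pe nq.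
have pq_lt := swp_lt sepE npar.
have npq : ptn G e.-1 <> ptn G e.
  move=> epq; have : e = e.-1 by rewrite -{1}pq -epq pp.
  by lia.
have nspq : swp E (ptn G e.-1) <> swp E (ptn G e) by move/(can_inj (swpK sepE)).
by rewrite /interlace pE pE1; apply: crossing_toggle.
Qed.

(** The number of heads and the product of signs are symmetric in the two ends of the edge; only the
    crossing changes. All three values are negated together, so their equality is preserved. *)
Lemma weps_swap e : e \in E -> weps (swap G E) e = ~~ weps G e.
Proof.
move=> eE; have [e0 lt1 lt2] := r3_edge eE; have sepE := r3_sep r3G.
rewrite /weps interlace_swap // /up.
have se := swp_edge sepE eE; have se1 := swp_pred sepE eE.
have hE : hd (swap G E) e = hd G e.-1 by rewrite -{1}se1 hd_swap.
have hE1 : hd (swap G E) e.-1 = hd G e by rewrite -se hd_swap.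
have sE : sgn (swap G E) e = sgn G e.-1 by rewrite -{1}se1 sgn_swap.
have sE1 : sgn (swap G E) e.-1 = sgn G e by rewrite -se sgn_swap.
by rewrite hE hE1 sE sE1 addnC [in LHS]eq_sym -!addNb.
Qed.

Lemma up_swap e : e \in E -> up (swap G E) e = up G e.
Proof.
move=> eE; have [e0 lt1 lt2] := r3_edge eE; have sepE := r3_sep r3G.
have se := swp_edge sepE eE; have se1 := swp_pred sepE eE.
by rewrite /up -{1}se -{2}se1 !hd_swap // addnC.
Qed.

(** No edge of the move is bounded by the two ends of one arrow, so the order of the ends of each
    arrow at [e] is not reversed and the name of the arrow moves with its smaller end. *)
Lemma ends_swap e : e \in E ->
  ends (swap G E) e = (swp E (aid G e), swp E (aid G e.-1)).
Proof.
move=> eE; have [e0 lt1 lt2] := r3_edge eE; have [/eqP pe1 /eqP pe] := r3_ptn eE.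
have sepE := r3_sep r3G; have se := swp_edge sepE eE; have se1 := swp_pred sepE eE.
have aid_swap j : j < size G -> swp E j <> ptn G j -> aid (swap G E) (swp E j) = swp E (aid G j).
  by move=> lt_j np; rewrite /aid ptn_swap // /minn (swp_lt sepE) // -fun_if.
by rewrite /ends -{1}se -{2}se1 !aid_swap ?se ?se1 //; apply: nesym.
Qed.

Lemma r3_swap : r3_allowed (swap G E) e1 e2 e3.
Proof.
have [E1 [E2 E3]] : e1 \in E /\ e2 \in E /\ e3 \in E by rewrite !inE !eqxx !orbT.
have injs := can_inj (swpK (r3_sep r3G)).
have [szE [[n1 n2 n3 n4 [p12 p13 p23]] [[w12 w23] u]]] := r3G.
have same_swap e f : e \in E -> f \in E ->
    same_pair (ends (swap G E) e) (ends (swap G E) f) = same_pair (ends G e) (ends G f).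
  by move=> eE fE; rewrite !ends_swap // /same_pair /= !(inj_eq injs)
    ![_ && (aid _ _.-1 == _)]andbC.
split; first by rewrite size_swap.
split; last by rewrite !weps_swap // w12 w23 !up_swap.
rewrite -/(ends _ e1) -/(ends _ e2) -/(ends _ e3) !same_swap //.
rewrite !ends_swap //.
split=> //; try by apply: nesym => /injs.
rewrite -n4 -[RHS](size_undup_map (f := swp E)); last by move=> x y _ _; apply: injs.
apply/perm_size/perm_undup => x; rewrite !inE.
by do 6!case: (x == _).
Qed.

End SwappedEdges.

(** * Subgerms and reversed germs *)

(** The definition imposes the conditions of the move on the computed diagram [g0 g]; by [r3_swap]
    and [swapK] they can equally be imposed on the stored diagram. *)
Lemma is_germ3P g : is_germ3 g <-> exists (G : gdiag) e1 e2 e3,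
  [/\ g = (3, G, [:: e1; e2; e3]), wf_gd G & r3_allowed G e1 e2 e3].
Proof.
case: g => [[k G] E]; split=> [[e1 [e2 [e3 []]]]|[G' [e1 [e2 [e3 [-> wfG r3G]]]]]].
  rewrite /kind /g1 /d1 /= => -> wfG -> r3G; exists G, e1, e2, e3; split=> //.
  move: r3G; rewrite /g0 /= => r3G.
  have sepE : sep (size G) [:: e1; e2; e3] by rewrite -(size_swap _ [:: e1; e2; e3]); apply: r3_sep.
  rewrite -[G](swapK sepE); apply: r3_swap => //.
  by apply: wf_swap => //; case/wf_gdP: wfG.
exists e1, e2, e3; split=> //; apply: r3_swap => //; by case/wf_gdP: wfG.
Qed.

Lemma germ3_sep g : is_germ3 g -> sep (size (g1 g)) (d1 g).
Proof. by case/is_germ3P => G [e1 [e2 [e3 [-> _ /r3_sep]]]]. Qed.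

Lemma germ3_wf g : is_germ3 g -> wf_gd (g1 g).
Proof. by case/is_germ3P => G [e1 [e2 [e3 [-> wfG _]]]]. Qed.

Lemma germ3_kind g : is_germ3 g -> kind g = 3.
Proof. by case/is_germ3P => G [e1 [e2 [e3 [-> _ _]]]]. Qed.

Lemma germ3_rev g : is_germ3 g -> is_germ3 (rev_germ g).
Proof.
case/is_germ3P => G [e1 [e2 [e3 [-> wfG r3G]]]]; have sepE := r3_sep r3G.
apply/is_germ3P; exists (swap G [:: e1; e2; e3]), e1, e2, e3; split=> //.
  exact: wf_gd_swap.
by apply: r3_swap => //; case/wf_gdP: wfG.
Qed.

Lemma subgE (L : Type) (g : germ L) m : kind g = 3 ->
  subg g m = (if all (kept m) (d1 g) then 3 else 4, restr (g1 g) m, kept_edges m (d1 g)).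
Proof. by move=> kg; rewrite /subg kg /=; case: all. Qed.

Lemma germ3_sub g m : is_germ3 g -> arrow_closed (g1 g) m -> all (kept m) (d1 g) ->
  is_germ3 (subg g m).
Proof.
move=> g3 cl km; rewrite subgE ?germ3_kind // km.
case/is_germ3P: g3 cl km => G [e1 [e2 [e3 [-> wfG r3G]]]]; rewrite /g1 /d1 => cl km.
apply/is_germ3P; exists (restr G m), (newpos m e1), (newpos m e2), (newpos m e3); split.
- by rewrite /kept_edges; case/and4P: km => /= -> -> ->.
- exact: wf_gd_restr.
- exact: r3_restr.
Qed.

Lemma g1_rev (L : Type) (g : germ L) : 2 < kind g -> g1 (rev_germ g) = swap (g1 g) (d1 g).
Proof. by move=> k3; rewrite [LHS]/(g0 g) /g0 leqNgt k3. Qed.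

(** A mask and its pull keep the same edges, and [restr_swap] identifies the diagrams. Hence the
    [G0] side of a subgerm is cut out of [G0] by the pulled mask. *)
Lemma rev_sub g m : is_germ3 g -> arrow_closed (g1 g) m ->
  rev_germ (subg g m) = subg (rev_germ g) (pull (d1 g) m).
Proof.
move=> g3 cl; have k3 := germ3_kind g3; have sepE := germ3_sep g3.
have sepm : sep (size m) (d1 g) by rewrite (arrow_closed_size cl).
rewrite !subgE //.
have -> : all (kept (pull (d1 g) m)) (d1 (rev_germ g)) = all (kept m) (d1 g).
  by apply: eq_in_all => e eE; rewrite kept_pull.
have -> : kept_edges (pull (d1 g) m) (d1 (rev_germ g)) = kept_edges m (d1 g).
  rewrite /kept_edges /rev_germ /d1 /= -/(d1 g).
  have -> : [seq e <- d1 g | kept (pull (d1 g) m) e] = [seq e <- d1 g | kept m e].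
    by apply: eq_in_filter => e eE; rewrite kept_pull.
  by apply/eq_in_map => e; rewrite mem_filter => /andP[ke eE]; rewrite newpos_pull_kept.
by rewrite g1_rev ?k3 // restr_swap //; case: all.
Qed.

(** * Partial 3-germs *)

Definition dpos (E : seq nat) := flatten [seq [:: e.-1; e] | e <- E].

Lemma mem_dpos (E : seq nat) j : reflect (exists2 e, e \in E & j = e.-1 \/ j = e) (j \in dpos E).
Proof.
apply: (iffP flatten_mapP) => -[e eE H]; exists e => //.
  by move: H; rewrite !inE => /orP[] /eqP; auto.
by case: H => ->; rewrite !inE eqxx ?orbT.
Qed.

Lemma dpos_lt N (E : seq nat) j : sep N E -> j \in dpos E -> j < N.
Proof. by case/sepP=> H _ /mem_dpos[e /H bnd [] ->]; lia. Qed.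

Lemma all_kept m (E : seq nat) : all (kept m) E = all (nth false m) (dpos E).
Proof. by elim: E => //= e E ->; rewrite /kept andbA. Qed.

Lemma dpos_swp N (E : seq nat) j : sep N E -> (swp E j \in dpos E) = (j \in dpos E).
Proof.
move=> sepE; suff H k : k \in dpos E -> swp E k \in dpos E.
  by apply/idP/idP => /H //; rewrite (swpK sepE).
case/mem_dpos=> e eE [->|->]; apply/mem_dpos; exists e => //.
  by right; rewrite (swp_pred sepE).
by left; rewrite (swp_edge sepE).
Qed.

(** For a closed mask: the arrow through [j] is the only distinguished arrow missing. Its partner
    end may be another distinguished position, whence the exemption of [ptn G j]. *)
Definition lacks_one (G : gdiag) (E : seq nat) m j :=
  [/\ j \in dpos E, ~~ nth false m j &
      forall k, k \in dpos E -> k != j -> k != ptn G j -> nth false m k].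

Lemma arrow_index_lt (L : Type) (D : diag L) j :
  wf D -> j < size D -> arrow_index D j < narrows D.
Proof. by move=> wfD lt_j; rewrite arrow_indexE // -size_openers // index_mem aid_opener. Qed.

Lemma arrow_index_eq (L : Type) (D : diag L) j k : wf D -> j < size D -> k < size D ->
  (arrow_index D j == arrow_index D k) = (j == k) || (j == ptn D k).
Proof. by move=> wfD lt_j lt_k; rewrite aid_inj_arrow // aid_eq. Qed.

Lemma germ3_amask_drop h j : is_germ3 h -> j \in dpos (d1 h) ->
  let m := amask (g1 h) [seq i != arrow_index (g1 h) j | i <- iota 0 (narrows (g1 h))] in
  forall k, k < size (g1 h) -> nth false m k = (k != j) && (k != ptn (g1 h) j).
Proof.
move=> h3 jE m k lt_k; have /wf_gdP[wfG _] := germ3_wf h3.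
have lt_j := dpos_lt (germ3_sep h3) jE.
rewrite nth_amask // (nth_map 0) ?size_iota ?nth_iota ?arrow_index_lt //.
by rewrite add0n arrow_index_eq // negb_or.
Qed.

Lemma kept_edges_mask (n m : bitseq) E : size m = size n ->
  (forall j, nth false m j -> nth false n j) -> all (kept n) E -> all (fun e => 0 < e) E ->
  kept_edges (mask n m) (kept_edges n E) = kept_edges m E.
Proof.
move=> sz le_mn /allP kn /allP posE.
have knm e : e \in E -> kept (mask n m) (newpos n e) = kept m e.
  move=> eE; rewrite /kept {1}(newpos_pred (kn e eE) (posE e eE)) /=.
  by have /andP[n1 n2] := kn e eE; rewrite !nth_mask_newpos.
rewrite /kept_edges filter_map -map_comp.
have -> : [seq e <- E | kept n e] = E by apply/all_filterP/allP.
rewrite (eq_in_filter (a2 := kept m)) //.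
by apply: eq_map => e; rewrite /= newpos_mask.
Qed.

(** [is_germ4] removes one distinguished arrow and nothing else, whereas a subgerm may lose other
    arrows too. The removal can be done in two stages: undistinguished arrows first, which leaves a
    3-germ, and the distinguished arrow last. *)
Lemma is_germ4P g : is_germ4 g <-> exists (h : germ bool) m j,
  [/\ is_germ3 h, arrow_closed (g1 h) m, lacks_one (g1 h) (d1 h) m j & g = subg h m].
Proof.
split=> [[h [a [h3 a_h ->]]]|[h [m [j [h3 cl [jE mj mk] ->]]]]].
  have /wf_gdP[wfG _] := germ3_wf h3; have sepE := germ3_sep h3.
  move: a_h; rewrite mem_undup -/(dpos _) => /mapP[j jE ->{a}].
  have dropE := germ3_amask_drop h3 jE.
  exists h; eexists; exists j; split=> //; first exact: arrow_closed_amask.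
  split=> //; first by rewrite dropE ?eqxx // (dpos_lt sepE).
  by move=> k kE kj kp; rewrite dropE ?kj // (dpos_lt sepE).
have k3 := germ3_kind h3; have /wf_gdP[wfG _] := germ3_wf h3; have sepE := germ3_sep h3.
have sz := arrow_closed_size cl; have lt_j := dpos_lt sepE jE.
have [lt_p np pp _] := wfP _ wfG _ lt_j.
(* The mask of the first stage: [m] with the arrow through [j] put back. *)
pose n := [seq [|| nth false m k, k == j | k == ptn (g1 h) j] | k <- iota 0 (size (g1 h))].
have szn : size n = size (g1 h) by rewrite size_map size_iota.
have nE k : k < size (g1 h) -> nth false n k = [|| nth false m k, k == j | k == ptn (g1 h) j].
  by move=> lt_k; rewrite (nth_map 0) ?size_iota // nth_iota.
have cln : arrow_closed (g1 h) n.
  apply/arrow_closedP; split=> // k lt_k; have [lt_q _ qq _] := wfP _ wfG _ lt_k.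
  rewrite !nE //; have /arrow_closedP[_ ->] := cl => //; congr orb.
  rewrite orbC; congr orb; last by apply/eqP/eqP => [<-//|->].
  by apply/eqP/eqP => [/(congr1 (ptn (g1 h)))|->//]; rewrite qq pp.
have le_mn k : nth false m k -> nth false n k.
  by move=> mk'; rewrite nE ?mk' // -sz mask_lt_size.
have kn : all (kept n) (d1 h).
  rewrite all_kept; apply/allP => k kE; rewrite nE ?(dpos_lt sepE kE) //.
  apply: contraT; rewrite !negb_or => /and3P[mk0 kj kp].
  by rewrite (mk k) in mk0.
have h'3 := germ3_sub h3 cln kn.
have nj : nth false n j by rewrite nE // eqxx orbT.
have sub1 : subg h n = (3, restr (g1 h) n, kept_edges n (d1 h)) by rewrite subgE // kn.
have posE : all (fun e => 0 < e) (d1 h).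
  by apply/allP => e eE; case/sepP: sepE => /(_ e eE)/andP[].
have j'E : newpos n j \in dpos (d1 (subg h n)).
  case/mem_dpos: jE => e eE je; rewrite sub1; apply/mem_dpos; exists (newpos n e).
    by rewrite /d1 /=; apply: map_f; rewrite mem_filter eE (allP kn).
  have [] := (allP kn e eE, allP posE e eE) => ke e0.
  by case: je => ->; [left; rewrite (newpos_pred ke e0) | right].
exists (subg h n), (arrow_index (restr (g1 h) n) (newpos n j)); split=> //.
  by rewrite mem_undup -/(dpos _) sub1 map_f // -sub1.
have := germ3_amask_drop h'3 j'E; rewrite sub1 /g1 /= -/(g1 h).
set m' := amask _ _ => m'E.
(* Second stage: dropping that arrow inside the restricted diagram is [m] read relative to [n]. *)
have -> : m' = mask n m.
  apply: eq_bitseq => [|p]; first by rewrite size_amask size_restr // size_mask // szn.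
  have [lt_r|ge_r] := ltnP p (size (restr (g1 h) n)); last first.
    by rewrite !nth_default ?size_amask // size_mask ?szn // -(size_restr szn).
  rewrite m'E //; move: lt_r; rewrite size_restr // => /newpos_surj[k nk ->].
  have lt_k : k < size (g1 h) by rewrite -szn mask_lt_size.
  rewrite ptn_restr // !newpos_eqE ?nth_mask_newpos ?(arrow_closed_ptn cln) //.
  move: nk; rewrite nE //; case: eqP => [->|_]; first by rewrite (negbTE mj).
  case: eqP => [->|_]; last by rewrite !orbF => ->.
  by have /arrow_closedP[_ ->] := cl; rewrite // (negbTE mj).
rewrite !subgE // /g1 /d1 /= -/(g1 h) -/(d1 h).
rewrite restr_restr // kept_edges_mask ?szn ?sz //.
congr (_, _, _); rewrite all_kept (_ : all _ _ = false); last first.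
  by apply/negbTE/allPn; exists j.
rewrite all_kept (_ : all _ _ = false) //.
apply/negbTE/allPn; exists (newpos n j); last by rewrite nth_mask_newpos.
by move: j'E; rewrite sub1.
Qed.

Lemma germ4_rev g : is_germ4 g -> is_germ4 (rev_germ g).
Proof.
case/is_germ4P=> h [m [j [h3 cl [jE mj mk] ->]]]; have sepE := germ3_sep h3.
have sepm : sep (size m) (d1 h) by rewrite (arrow_closed_size cl).
have lt_j := dpos_lt sepE jE.
have g0E : g1 (rev_germ h) = swap (g1 h) (d1 h) by rewrite g1_rev ?germ3_kind.
apply/is_germ4P; exists (rev_germ h), (pull (d1 h) m), (swp (d1 h) j); split.
- exact: germ3_rev.
- by rewrite g0E; apply: arrow_closed_pull.
- rewrite g0E; split; rewrite /= ?(dpos_swp _ sepE) //.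
    by rewrite nth_pull // (swpK sepE).
  move=> k kE kj kp; rewrite nth_pull //; apply: mk; first by rewrite (dpos_swp _ sepE).
    by apply: contraNneq kj => <-; rewrite (swpK sepE).
  by apply: contraNneq kp => E; rewrite ptn_swap // -E (swpK sepE).
- exact: rev_sub.
Qed.

Lemma germ4_sub3 g : is_germ4 g -> exists (h : germ bool) m,
  [/\ is_germ3 h, arrow_closed (g1 h) m, g = subg h m & ~~ all (kept m) (d1 h)].
Proof.
case/is_germ4P=> h [m [j [h3 cl [jE mj mk] ->]]]; exists h, m; split=> //.
by rewrite all_kept; apply/allPn; exists j.
Qed.

Local Open Scope ring_scope.

(** * Pairing with the coboundary *)

Lemma decP P : reflect P (dec P).
Proof. by rewrite /dec; case: ClassicalEpsilon.excluded_middle_informative; constructor. Qed.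

Lemma germ_kind g : is_germ g ->
  [\/ kind g = 1%N /\ is_germ1 g, kind g = 2%N /\ is_germ2 g,
      kind g = 3%N /\ is_germ3 g | kind g = 4%N /\ is_germ4 g].
Proof. by rewrite /is_germ; case: (kind g) => [|[|[|[|[|]]]]] // H; constructor. Qed.

Lemma germ4_kind g : is_germ4 g -> kind g = 4%N.
Proof.
by case/germ4_sub3=> h [m [h3 _ -> /negbTE km]]; rewrite (subgE _ (germ3_kind h3)) km.
Qed.

Lemma germ_wf_sep g : is_germ g -> wf_gd (g1 g) /\ sep (size (g1 g)) (d1 g).
Proof.
case/germ_kind=> [[_ [e [_ wfG -> be _]]]|[_ [e [f [_ wfG -> [e0 ef fN] _]]]]|[_ g3]|[_]].
- by split=> //; rewrite /sep /= be.
- by split=> //; rewrite /sep /= ef e0 fN /=; lia.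
- by split; [apply: germ3_wf | apply: germ3_sep].
case/germ4_sub3=> h [m [h3 cl -> _]]; have sz := arrow_closed_size cl.
rewrite subgE ?germ3_kind //; split; first exact: wf_gd_restr (germ3_wf h3) cl.
by rewrite [size _](size_restr sz); apply: sep_kept_edges; rewrite sz; apply: germ3_sep.
Qed.

Lemma size_nmask (L : Type) (D : diag L) E : size (nmask D E) = size D.
Proof. by rewrite size_map size_iota. Qed.

(** Provides the size condition in [d_d]: [g0] either deletes endpoints or permutes them. *)
Lemma germ_size (L : Type) (g : germ L) : (size (g0 g) <= size (g1 g))%N.
Proof.
rewrite /g0; case: ifP => _; last by rewrite size_swap.
by rewrite size_restr ?size_nmask // -[leqRHS](size_nmask _ (d1 g)) count_size.
Qed.

Lemma kind_rev (L : Type) (g : germ L) : kind (rev_germ g) = kind g.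
Proof. by []. Qed.

Lemma germ_rev g : is_germ g -> (2 < kind g)%N -> is_germ (rev_germ g).
Proof.
case/germ_kind=> [[-> _]|[-> _]|[k3 g3]|[k4 g4]] // _; rewrite /is_germ kind_rev.
  by rewrite k3; apply: germ3_rev.
by rewrite k4; apply: germ4_rev.
Qed.

Lemma rev_germK g : is_germ g -> (2 < kind g)%N -> rev_germ (rev_germ g) = g.
Proof.
move=> gg k3; have [_ sepE] := germ_wf_sep gg.
rewrite {1}/rev_germ; have -> : g0 (rev_germ g) = g1 g.
  by rewrite /g0 kind_rev leqNgt k3 g1_rev // swapK.
by case: g {gg k3 sepE} => [[]].
Qed.

Lemma sub_subs (s t : seq nat) : t \in subs s -> {subset t <= s}.
Proof.
elim: s t => [|x s IH] t /=; first by rewrite inE => /eqP->.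
rewrite mem_cat => /orP[/mapP[u /IH us ->]|/IH ts] y; rewrite !inE.
  by case/orP=> [->//|/us->]; rewrite orbT.
by move/ts->; rewrite orbT.
Qed.

Lemma uniq_subs s : uniq s -> uniq (subs s).
Proof.
elim: s => //= x s IH /andP[xs us]; rewrite cat_uniq IH // map_inj_uniq ?IH //=;
  last by move=> ? ? [].
rewrite andbT; apply/hasPn => t /sub_subs ts; apply/mapP => -[u _ tu].
by move: (ts x); rewrite tu inE eqxx (negbTE xs) => /(_ isT).
Qed.

Lemma filter_subs (P : pred nat) s : [seq x <- s | P x] \in subs s.
Proof.
by elim: s => //= x s IH; rewrite mem_cat; case: (P x); rewrite ?map_f // IH orbT.
Qed.

(** An increasing list is the filter of the range by its own members, so the distinguished edges of
    every germ occur in the enumeration of [d_d]. *)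
Lemma sep_subs N E : sep N E -> E \in subs (iota 0 N.+1).
Proof.
case/andP=> srtE /allP bndE.
suff -> : E = [seq x <- iota 0 N.+1 | x \in E] by apply: filter_subs.
apply: (irr_sorted_eq ltn_trans ltnn).
- by apply: sub_sorted srtE => x y /=; lia.
- by apply: sorted_filter (iota_ltn_sorted _ _); apply: ltn_trans.
- move=> x; rewrite mem_filter mem_iota; case xE: (x \in E) => //=.
  by have := bndE x xE; lia.
Qed.

(** * Linear extension, and the pairings as iterated evaluations *)

Definition ev (T : Type) (F : T -> rat) (x : lc T) : rat := \sum_(u <- x) u.1 * F u.2.

Lemma ev_lin (T U : Type) (F : U -> rat) (f : T -> lc U) x :
  ev F (lin f x) = ev (fun t => ev F (f t)) x.
Proof.
rewrite /ev /lin big_flatten /= big_map; apply: eq_bigr => u _.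
by rewrite big_map mulr_sumr; apply: eq_bigr => v _; rewrite mulrA.
Qed.

Lemma ev_exchange (T U : Type) (F : T -> U -> rat) x y :
  ev (fun t => ev (F t) y) x = ev (fun u => ev (F^~ u) x) y.
Proof.
rewrite /ev; under eq_bigr do rewrite mulr_sumr.
rewrite exchange_big; apply: eq_bigr => v _; rewrite mulr_sumr.
by apply: eq_bigr => u _; rewrite mulrCA.
Qed.

Lemma eq_ev (T : eqType) (F H : T -> rat) (x : lc T) :
  (forall u, u \in x -> F u.2 = H u.2) -> ev F x = ev H x.
Proof. by move=> eqF; apply: eq_big_seq => u /eqF->. Qed.

Lemma ev_seq1 (T U : Type) (P : pred U) (f : U -> T) (F : T -> rat) s :
  ev F [seq (1, f i) | i <- s & P i] = \sum_(i <- s | P i) F (f i).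
Proof. by rewrite /ev big_map big_filter; apply: eq_bigr => i _; rewrite mul1r. Qed.

(** Ordered so that the subgerm [v] is fixed before the signed germs of [S_g a] are summed; the
    innermost evaluation then extracts a coefficient. *)
Lemma pairGE x y : pairG x y =
  ev (fun a => ev (fun g => ev (fun v => ev (bG^~ v) (S_g a)) (I_g g)) y) x.
Proof.
rewrite /pairG /spG; transitivity (ev (fun u => ev (bG u) (lin I_g y)) (lin S_g x)).
  rewrite /ev; apply: eq_bigr => u _; rewrite mulr_sumr.
  by apply: eq_bigr => v _; rewrite mulrA.
rewrite ev_lin; apply: eq_bigr => a _; congr (_ * _).
by rewrite ev_exchange ev_lin.
Qed.

Lemma pairDE x y : pairD x y =
  ev (fun a => ev (fun D => ev (fun H => ev (fun u => (u == H)%:R) (S_d a)) (I_d D)) y) x.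
Proof.
rewrite /pairD /spD.
transitivity (ev (fun u => ev (fun v => (u == v)%:R) (lin I_d y)) (lin S_d x)).
  rewrite /ev; apply: eq_bigr => u _; rewrite mulr_sumr.
  by apply: eq_bigr => v _; rewrite mulrA.
rewrite ev_lin; apply: eq_bigr => a _; congr (_ * _).
by rewrite ev_exchange ev_lin.
Qed.

Lemma ev_S_d (A : adiag) (H : gdiag) : wf A -> wf_gd H ->
  ev (fun u => (u == H)%:R) (S_d A) = weight A H.
Proof. by move=> wfA wfH; rewrite /ev big_map sum_signD. Qed.

(** The filter in [S_g] only discards signings that are not germs, and none of these equals [d]. *)
Lemma ev_S_g (k : nat) (A : adiag) (E : seq nat) d : wf A -> is_germ d ->
  ev (fun u => (u == d)%:R) (S_g (k, A, E))
  = ((k, A, E) == (kind d, A, d1 d))%:R * weight A (g1 d).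
Proof.
move=> wfA germ_d; have [wfG _] := germ_wf_sep germ_d.
rewrite /ev big_map big_filter -sum_signD // mulr_sumr big_mkcond.
apply: eq_bigr => s _; case: d germ_d {wfG} => [[k' G] E'] germ_d /=.
rewrite /sign_germ /kind /g1 /d1 /= !xpair_eqE eqxx andbT.
rewrite [_ && (E == E')]andbAC; case: (eqVneq k k') => [->|_] /=; last first.
  by rewrite mul0r mulr0 if_same.
case: (eqVneq E E') => [->|_] /=; last by rewrite mul0r mulr0 if_same.
rewrite mul1r; case: eqP => [->|_]; last by rewrite mulr0 if_same.
by case: decP.
Qed.

(** Only the arrow germ underlying [d] can contribute. It occurs once in [d_d A] if [A] underlies
    [g1 d], and otherwise not at all, so [d] has the same coefficient in S(dA) as [g1 d] has in
    S(A). *)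
Lemma ev_d_d_S_g (A : adiag) d : wf A -> is_germ d ->
  ev (fun a => ev (fun u => (u == d)%:R) (S_g a)) (d_d A) = weight A (g1 d).
Proof.
move=> wfA germ_d; have [wfG sepE] := germ_wf_sep germ_d.
rewrite ev_seq1.
transitivity (\sum_(a <- [seq (k, A, E) | k <- [:: 1; 2; 3; 4]%N, E <- subs (iota 0 (size A).+1)]
                    | dec (is_agerm a /\ (size (g0 a) <= size (g1 a))%N))
                 weight A (g1 d) * (a == (kind d, A, d1 d))%:R).
  rewrite big_seq_cond [RHS]big_seq_cond; apply: eq_bigr => a /andP[/allpairsP[[k E] [_ _ ->]] _].
  by rewrite ev_S_g // mulrC.
rewrite -big_filter sum_delta; last first.
  rewrite filter_uniq //; apply: allpairs_uniq; rewrite ?uniq_subs ?iota_uniq //.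
  by move=> [k E] [k' E'] _ _ [-> ->].
case: ifP => //; rewrite /weight; case: eqP => // fA /negbT/negP[].
rewrite mem_filter; apply/andP; split.
  apply/decP; split; last exact: germ_size.
  by exists d; split=> //; rewrite /forget_germ fA.
apply: allpairs_f; last by rewrite -fA size_forget; apply: sep_subs.
by case/germ_kind: germ_d => -[-> _].
Qed.

(** A difference of two Kronecker symbols, so that coefficients can be extracted at [d] and at its
    reverse separately. *)
Lemma bG_germ g d : is_germ g -> is_germ d -> ((2 < kind d)%N -> rev_germ d != d) ->
  bG g d = (g == d)%:R - (2 < kind d)%:R * (g == rev_germ d)%:R.
Proof.
move=> germ_g germ_d rev_d; rewrite /bG.
case: (eqVneq g d) rev_d => [<-|gd] rev_g.
  case: (ltnP 2 (kind g)) rev_g => [_ /(_ isT)|_ _]; last by rewrite mul0r subr0.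
  by rewrite eq_sym => /negbTE->; rewrite mulr0 subr0.
case: ifP => [/andP[k3 /eqP dE]|].
  have kd : kind d = kind g by rewrite dE.
  by rewrite kd k3 dE rev_germK // eqxx mul1r sub0r.
rewrite sub0r; case: (ltnP 2 (kind d)) => [k3|_]; last by rewrite mul0r oppr0.
case: (eqVneq g (rev_germ d)) => [->|_ _]; last by rewrite mulr0 oppr0.
by rewrite rev_germK // eqxx kind_rev k3.
Qed.

(** As [g1 (rev_germ d)] is [g0 d], a germ of the third move or a partial one contributes the
    weights of both its diagrams, and a birth only that of the larger one. *)
Lemma ev_coboundary (A : adiag) d : wf A -> is_germ d ->
  ((2 < kind d)%N -> rev_germ d != d) ->
  ev (fun a => ev (bG^~ d) (S_g a)) (d_d A)
  = weight A (g1 d) - (2 < kind d)%:R * weight A (g1 (rev_germ d)).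
Proof.
move=> wfA germ_d rev_d.
transitivity (ev (fun a => ev (fun u => (u == d)%:R) (S_g a)
    - (2 < kind d)%:R * ev (fun u => (u == rev_germ d)%:R) (S_g a)) (d_d A)).
  apply: eq_bigr => a _; congr (_ * _).
  rewrite /ev mulr_sumr -sumrB; apply: eq_big_seq => u /mapP[s].
  rewrite mem_filter => /andP[/decP germ_s _] -> /=.
  by rewrite bG_germ // mulrBr mulrCA.
rewrite -ev_d_d_S_g //; case: (ltnP 2 (kind d)) => [k3|_].
  rewrite -[in RHS](ev_d_d_S_g wfA (germ_rev germ_d k3)) /ev mul1r -sumrB.
  by apply: eq_bigr => a _; rewrite mul1r mulrBr.
by rewrite mul0r subr0; apply: eq_bigr => a _; rewrite mul0r subr0.
Qed.

(** * The third move *)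

Section ThirdMove.
Local Open Scope nat_scope.

Lemma count_gt1 (T : eqType) (P : pred T) s a b :
  uniq s -> a \in s -> b \in s -> a != b -> P a -> P b -> 1 < count P s.
Proof.
move=> us as_ bs ab Pa Pb; rewrite -size_filter.
apply: (@uniq_leq_size _ [:: a; b]); first by rewrite /= inE ab.
by move=> x; rewrite !inE mem_filter => /orP[] /eqP->; rewrite ?Pa ?Pb.
Qed.

Variable g : germ bool.
Hypothesis g3 : is_germ3 g.
Let G := g1 g.
Let E := d1 g.
Let k3 : kind g = 3 := germ3_kind g3.
Let wfG : wf G. Proof. by case/wf_gdP: (germ3_wf g3). Qed.
Let sepE : sep (size G) E := germ3_sep g3.

Lemma size_darrs : size (undup [seq aid G j | j <- dpos E]) = 3.
Proof.
by rewrite /G /E; case/is_germ3P: g3 => H [e1 [e2 [e3 [-> _ [_ [[_ _ _ n4 _] _]]]]]].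
Qed.

Lemma darrsE : darrs g = undup [seq index a (openers G) | a <- [seq aid G j | j <- dpos E]].
Proof.
rewrite /darrs -/(dpos E) -map_comp; congr undup.
by apply/eq_in_map => j /(dpos_lt sepE) lt_j; rewrite /= arrow_indexE.
Qed.

Lemma size_darrs3 : size (darrs g) = 3.
Proof.
rewrite darrsE size_undup_map ?size_darrs //.
move=> a b /mapP[j /(dpos_lt sepE) lt_j ->] /mapP[k /(dpos_lt sepE) lt_k ->].
by move/(congr1 (nth 0 (openers G))); rewrite !nth_index ?aid_opener.
Qed.

Lemma mem_darrs j : j \in dpos E -> arrow_index G j \in darrs g.
Proof. by move=> jE; rewrite mem_undup -/(dpos E) map_f. Qed.

Lemma ends_neq e : e \in E -> aid G e.-1 != aid G e.
Proof.
rewrite /G /E; case/is_germ3P: g3 => H [e1 [e2 [e3 [-> _ r3]]]]; exact: (r3_ends r3).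
Qed.

Lemma ends_not_same e f : e \in E -> f \in E -> e != f -> ~~ same_pair (ends G e) (ends G f).
Proof.
rewrite /G /E; case/is_germ3P: g3 => H [e1 [e2 [e3 [-> _ r3]]]]; exact: (r3_not_same_pair r3).
Qed.

Lemma not_parallel e : e \in E -> swp E (ptn G e.-1) != ptn G e.
Proof.
move: wfG; rewrite /G /E; case/is_germ3P: g3 => H [e1 [e2 [e3 [-> _ r3]]]] wfH.
exact: (r3_not_parallel wfH r3).
Qed.

Lemma dpos_edge e : e \in E -> e.-1 \in dpos E /\ e \in dpos E.
Proof. by move=> eE; split; apply/mem_dpos; exists e; auto. Qed.

(** The partner of one end of a kept edge tells the two diagrams apart. If they agreed, the far ends
    of the two arrows at [e] would coincide or the swap would carry one to the other, which
    [not_parallel] excludes. *)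
Lemma rev_sub_neq m e : arrow_closed G m -> e \in E -> kept m e ->
  rev_germ (subg g m) != subg g m.
Proof.
move=> cl eE ke; apply/eqP; rewrite rev_sub // !subgE // => -[_ + _].
rewrite g1_rev ?k3 // -/G -/E => eqG.
have sz := arrow_closed_size cl; have sepm : sep (size m) E by rewrite sz.
have [me1 me] : nth false m e.-1 /\ nth false m e by case/andP: ke.
have szp : size (pull E m) = size (swap G E) by rewrite size_pull size_swap.
have [e1E eE'] := dpos_edge eE.
have [lt1 lt2] := (dpos_lt sepE e1E, dpos_lt sepE eE').
have [_ _ pp _] := wfP _ wfG _ lt1; have [_ _ qq _] := wfP _ wfG _ lt2.
have := congr1 (fun D => ptn D (newpos m e)) eqG.
rewrite (ptn_restr sz me) -{1}(newpos_pull_kept sepm eE ke) ptn_restr //; last first.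
  by rewrite nth_pull // (swp_edge sepE).
rewrite -{1}(swp_pred sepE eE) ptn_swap //.
have mp := arrow_closed_ptn cl me1; have mq := arrow_closed_ptn cl me.
have npar := not_parallel eE.
have npq : ptn G e.-1 <> ptn G e.
  move=> epq; have : e = e.-1 by rewrite -[LHS]qq -epq pp.
  by case/sepP: sepE => /(_ e eE) /andP[e0 _] _; clear -e0; lia.
move: (ptn G e.-1) (ptn G e) mp mq npar npq => p q mp mq /eqP npar npq.
case: (swpP sepE p) npar => [p1 p0|p0 pE p1|p0 p1] npar.
- rewrite newpos_pull_edge //=; case mp1: (nth false m p.+1); last first.
    by rewrite addn0 => /(newpos_inj mp mq).
  by rewrite addn1 => eq_pq; apply/npar/(newpos_inj mp1 mq); rewrite newposS mp addn1.
- rewrite newpos_pull //; last first.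
    by apply/negP=> pE1; case/sepP: sepE => _ /(_ _ pE1); rewrite prednK // pE.
  case mp1: (nth false m p.-1); first by move/(newpos_inj mp1 mq).
  move=> eq_pq; by apply/npq/(newpos_inj mp mq); rewrite -(prednK p0) newposS mp1 addn0.
- by rewrite newpos_pull // => /(newpos_inj mp mq).
Qed.

(** At least two of the three distinguished arrows are missing, while a kept edge needs two distinct
    ones present. *)
Lemma kept_edges_nil m t : m = amask G t -> ~~ allowed g t -> kept_edges m E = [::].
Proof.
move=> -> ; rewrite /allowed k3 /= -ltnNge => lt1.
apply/eqP; rewrite -size_eq0 size_map size_filter -leqn0 leqNgt -has_count.
apply/hasPn => e eE; apply/negP => /andP[].
have [e1E eE'] := dpos_edge eE.
rewrite !nth_amask ?(dpos_lt sepE) // => t1 t2.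
have := count_predC (fun a => ~~ nth false t a) (darrs g); rewrite size_darrs3.
have : 1 < count (predC (fun a => ~~ nth false t a)) (darrs g).
  apply: (count_gt1 (a := arrow_index G e.-1) (b := arrow_index G e)); rewrite ?mem_darrs //=.
  - exact: undup_uniq.
  - by rewrite aid_inj_arrow ?ends_neq // (dpos_lt sepE).
  - by rewrite negbK.
  - by rewrite negbK.
by lia.
Qed.

Lemma allowed_lacks m t : m = amask G t -> allowed g t ->
  all (kept m) E \/ exists j, lacks_one G E m j.
Proof.
move=> mE; rewrite /allowed k3 /= => le1.
have nthm j : j \in dpos E -> nth false m j = nth false t (arrow_index G j).
  by move=> jE; rewrite mE nth_amask // (dpos_lt sepE).
rewrite all_kept; have [|/allPn[j jE mj]] := boolP (all _ _); first by left.
right; exists j; split=> // k kE kj kp; apply: contraTT le1 => mk; rewrite -ltnNge.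
apply: (count_gt1 (a := arrow_index G j) (b := arrow_index G k)); rewrite ?mem_darrs -?nthm //.
  exact: undup_uniq.
by rewrite eq_sym arrow_index_eq ?(dpos_lt sepE) // negb_or kj.
Qed.

(** Pigeonhole: if no edge were kept, all three would touch the missing arrow. Their other arrows
    would be pairwise distinct, since no two edges join the same pair, and this makes four arrows
    out of three. *)
Lemma lacks_one_kept m j : arrow_closed G m -> lacks_one G E m j -> has (kept m) E.
Proof.
move=> cl [jE mj mk]; apply: contraT => /hasPn noE.
have lt_j := dpos_lt sepE jE.
have aid_j k : k \in dpos E -> ~~ nth false m k -> aid G k = aid G j.
  move=> kE mk'; apply/eqP; rewrite aid_eq ?(dpos_lt sepE) //; apply: contraR mk'.
  by rewrite negb_or => /andP[kj kp]; apply: mk.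
pose other e := if aid G e == aid G j then aid G e.-1 else aid G e.
have other_spec e : e \in E ->
    other e != aid G j /\ same_pair (ends G e) (aid G j, other e).
  move=> eE; have := ends_neq eE; have [e1E eE'] := dpos_edge eE.
  rewrite /other /same_pair /=; case: (aid G e =P aid G j) => [->|/eqP ne _];
    first by split; rewrite ?eqxx ?orbT.
  split=> //; rewrite eqxx andbT (aid_j e.-1) ?eqxx //.
  have := noE e eE; rewrite negb_and => /orP[//|me].
  by rewrite (aid_j e) ?eqxx in ne.
have other_inj e f : e \in E -> f \in E -> e != f -> other e != other f.
  move=> eE fE /(ends_not_same eE fE); apply: contraNneq => ef.
  have [_] := other_spec e eE; have [_] := other_spec f fE; rewrite ef.
  rewrite /same_pair /=.
  by do 2![case/orP=> /andP[/eqP-> /eqP->]]; rewrite !eqxx ?orbT.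
have aid_in k : k \in dpos E -> aid G k \in undup [seq aid G j | j <- dpos E].
  by move=> kE; rewrite mem_undup map_f.
have other_in e : e \in E -> other e \in undup [seq aid G j | j <- dpos E].
  by move=> /dpos_edge[? ?]; rewrite /other; case: ifP => _; apply: aid_in.
have uE : uniq E.
  by case/andP: sepE => srtE _; apply: sorted_uniq srtE; [apply: sep_rel_trans | move=> x; lia].
have szE : size E = 3 by rewrite /E; case/is_germ3P: g3 => H [e1 [e2 [e3 [-> _ _]]]].
suff : size (aid G j :: map other E) <= size (undup [seq aid G j | j <- dpos E]).
  by rewrite size_darrs /= size_map szE.
apply: uniq_leq_size => [|x].
  rewrite /= map_inj_in_uniq ?uE ?andbT.
    by apply/mapP => -[e eE je]; have [] := other_spec e eE; rewrite -je eqxx.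
  by move=> e f eE fE ef; apply/eqP; apply: contraT => /(other_inj e f eE fE); rewrite ef eqxx.
by rewrite inE => /orP[/eqP->|/mapP[e eE ->]]; [apply: aid_in | apply: other_in].
Qed.

Lemma subg_allowed m t : m = amask G t -> allowed g t ->
  [/\ is_germ (subg g m), 2 < kind (subg g m) & rev_germ (subg g m) != subg g m].
Proof.
move=> mE al; have cl : arrow_closed G m by rewrite mE; apply: arrow_closed_amask.
case: (allowed_lacks mE al) => [km|[j lj]].
  have h3 := germ3_sub g3 cl km; rewrite /is_germ (germ3_kind h3); split=> //.
  have [e eE] : exists e, e \in E.
    by rewrite /E; case/is_germ3P: g3 => H [e1 [e2 [e3 [-> _ _]]]]; exists e1; rewrite inE eqxx.
  by apply: (rev_sub_neq cl eE); apply: (allP km).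
have h4 : is_germ4 (subg g m) by apply/is_germ4P; exists g, m, j.
rewrite /is_germ (germ4_kind h4); split=> //.
have /hasP[e eE ke] := lacks_one_kept cl lj.
exact: rev_sub_neq cl eE ke.
Qed.

End ThirdMove.

(** * Reindexing sums over arrow subsets *)

Lemma sum_amask (L : Type) (D : diag L) (F : bitseq -> rat) : wf D ->
  \sum_(t <- bseqs (narrows D)) F (amask D t) = \sum_(m <- vmasks D) F m.
Proof. by move=> wfD; rewrite -(perm_big _ (perm_amask wfD)) big_map. Qed.

Lemma sum_pull (L : Type) (D : diag L) E (F : bitseq -> rat) : wf D -> sep (size D) E ->
  \sum_(m <- vmasks (swap D E)) F m = \sum_(m <- vmasks D) F (pull E m).
Proof.
move=> wfD sepE; have sepS : sep (size (swap D E)) E by rewrite size_swap.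
rewrite -(big_map (pull E) predT F); apply: perm_big; apply: uniq_perm.
- exact: uniq_vmasks.
- rewrite map_inj_in_uniq ?uniq_vmasks // => m n; rewrite !mem_vmasks.
  move=> /arrow_closed_size szm /arrow_closed_size szn /(congr1 (pull E)).
  by rewrite !pullK ?szm ?szn.
move=> m; rewrite mem_vmasks; apply/idP/mapP => [cl|[n + ->]]; last first.
  by rewrite mem_vmasks; apply: arrow_closed_pull.
have szm := arrow_closed_size cl.
exists (pull E m); last by rewrite pullK ?szm.
by rewrite mem_vmasks -[D in arrow_closed D _](swapK sepE); apply: arrow_closed_pull.
Qed.

Definition sub_mask (m n : bitseq) :=
  all (fun j => nth false m j ==> nth false n j) (iota 0 (size m)).

Lemma sub_maskP (m n : bitseq) :
  reflect (forall j, nth false m j -> nth false n j) (sub_mask m n).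
Proof.
apply: (iffP allP) => [H j mj|H j _]; last by apply/implyP/H.
by move/(_ j): H; rewrite mem_iota /= mask_lt_size // mj => /(_ isT).
Qed.

Lemma sum_restr (L : Type) (D : diag L) n (F : bitseq -> rat) : arrow_closed D n ->
  \sum_(m <- vmasks (restr D n)) F m = \sum_(m <- vmasks D | sub_mask m n) F (mask n m).
Proof.
move=> cln; have szn := arrow_closed_size cln.
rewrite -[RHS]big_filter -(big_map (mask n) predT F); apply: perm_big; apply: uniq_perm.
- exact: uniq_vmasks.
- rewrite map_inj_in_uniq 1?filter_uniq ?uniq_vmasks // => m1 m2.
  rewrite [m1 \in _]mem_filter [m2 \in _]mem_filter !mem_vmasks.
  move=> /andP[/sub_maskP le1 /arrow_closed_size sz1].
  move=> /andP[/sub_maskP le2 /arrow_closed_size sz2] eq12.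
  apply: eq_bitseq => [|j]; first by rewrite sz1.
  case nj: (nth false n j); first by rewrite -!(nth_mask_newpos _ _ nj) eq12.
  by apply/idP/idP => [/le1|/le2]; rewrite nj.
move=> m; rewrite mem_vmasks; apply/idP/mapP => [cl|[n' + ->]]; last first.
  by rewrite mem_filter mem_vmasks => /andP[_]; apply: arrow_closed_mask.
(* The lift of [m] to [D]: false off [n], and read through the renumbering on [n]. *)
pose x := [seq nth false n j && nth false m (newpos n j) | j <- iota 0 (size D)].
have szx : size x = size D by rewrite size_map size_iota.
have xE j : nth false x j = nth false n j && nth false m (newpos n j).
  have [lt_j|ge_j] := ltnP j (size D); first by rewrite (nth_map 0%N) ?size_iota // nth_iota.
  by rewrite nth_default ?szx // [nth false n j]nth_default ?szn.
exists x; last first.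
  have szm := arrow_closed_size cl; rewrite size_restr // in szm.
  apply: eq_bitseq => [|p]; first by rewrite szm size_mask ?szx.
  have [lt_p|ge_p] := ltnP p (count id n); last by rewrite !nth_default ?szm // size_mask ?szx.
  have [j nj ->] := newpos_surj lt_p.
  by rewrite nth_mask_newpos // xE nj.
rewrite mem_filter mem_vmasks; apply/andP; split.
  by apply/sub_maskP => j; rewrite xE => /andP[].
apply/arrow_closedP; split=> // j lt_j; rewrite !xE.
have /arrow_closedP[_ ->] := cln => //; case nj: (nth false n j) => //=.
rewrite -(ptn_restr szn nj); have /arrow_closedP[_ ->] := cl => //.
by rewrite size_restr // newpos_lt_count.
Qed.

(** * Deleting the distinguished arrows *)

Section Erase.
Variables (L : Type) (D : diag L) (E : seq nat).
Hypotheses (wfD : wf D) (sepE : sep (size D) E).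
Hypothesis ptnE : forall j, j \in dpos E -> ptn D j \in dpos E.

Lemma nth_nmask j : (j < size D)%N -> nth false (nmask D E) j = (j \notin dpos E).
Proof.
move=> lt_j; rewrite (nth_map 0%N) ?size_iota // nth_iota // add0n; congr negb.
apply/orP/mem_dpos => [[jE|jE]|[e eE [je|->]]]; last by right.
- by exists j.+1; auto.
- by exists j; auto.
- by left; case/sepP: sepE => /(_ e eE) /andP[e0 _] _; rewrite je prednK.
Qed.

Lemma arrow_closed_nmask : arrow_closed D (nmask D E).
Proof.
apply/arrow_closedP; split=> [|j lt_j]; first exact: size_nmask.
have [lt_p _ pp _] := wfP _ wfD _ lt_j; rewrite !nth_nmask //; congr negb.
by apply/idP/idP => [/ptnE|/ptnE //]; rewrite pp.
Qed.

Lemma sub_nmask m : size m = size D ->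
  sub_mask m (nmask D E) = ~~ has (nth false m) (dpos E).
Proof.
move=> sz; apply/sub_maskP/hasPn => H j.
  by move=> jE; apply: contraL (jE) => /H; rewrite nth_nmask // (dpos_lt sepE).
move=> mj; rewrite nth_nmask; last by rewrite -sz mask_lt_size.
by apply: contraL mj => /H.
Qed.

(** For the first two moves [G0] is [G1] without its distinguished arrows, and its arrow subsets are
    those of [G1] that miss every distinguished position. *)
Lemma sum_erase (F : diag L -> rat) :
  \sum_(m <- vmasks (restr D (nmask D E))) F (restr (restr D (nmask D E)) m)
  = \sum_(m <- vmasks D | ~~ has (nth false m) (dpos E)) F (restr D m).
Proof.
rewrite (sum_restr _ arrow_closed_nmask) big_seq_cond [RHS]big_seq_cond.
apply: eq_big => [m|m]; last first.
  rewrite mem_vmasks => /andP[/arrow_closed_size sz /sub_maskP le].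
  by rewrite restr_restr ?size_nmask.
rewrite mem_vmasks; apply: andb_id2l => /arrow_closed_size; exact: sub_nmask.
Qed.

End Erase.

(** * The first and second moves *)

Lemma subgE2 (L : Type) (g : germ L) m : (kind g <= 2)%N ->
  subg g m = (kind g, restr (g1 g) m, kept_edges m (d1 g)).
Proof. by rewrite /subg; case: (kind g) => [|[|[|[]]]]. Qed.

Lemma germ1_sub g m : is_germ1 g -> arrow_closed (g1 g) m -> all (kept m) (d1 g) ->
  is_germ1 (subg g m).
Proof.
case: g => [[k G] E0] [e []]; rewrite /kind /g1 /d1 /= => -> wfG -> /andP[e0 eN] pe cl.
rewrite /= andbT => ke; have sz := arrow_closed_size cl.
have [me1 me] : nth false m e.-1 /\ nth false m e by case/andP: ke.
exists (newpos m e); rewrite subgE2 // /kind /g1 /d1 /=; split=> //.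
- exact: wf_gd_restr.
- by rewrite /kept_edges /= ke.
- by rewrite (newpos_pred ke e0) /= -(newpos_pred ke e0) size_restr // newpos_lt_count.
- by rewrite {1}(newpos_pred ke e0) /= ptn_restr // pe.
Qed.

Lemma germ2_sub g m : is_germ2 g -> arrow_closed (g1 g) m -> all (kept m) (d1 g) ->
  is_germ2 (subg g m).
Proof.
case: g => [[k G] E0] [e [f []]]; rewrite /kind /g1 /d1 /=.
move=> -> wfG -> [e0 ef fN] [pef hdE sgnE] cl; rewrite /= andbT => /andP[ke kf].
have sz := arrow_closed_size cl.
have f0 : (0 < f)%N := ltn_trans (ltn0Sn _) ef.
have [me1 me] : nth false m e.-1 /\ nth false m e by case/andP: ke.
have [mf1 mf] : nth false m f.-1 /\ nth false m f by case/andP: kf.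
have ne1 : (newpos m e).-1 = newpos m e.-1 by rewrite (newpos_pred ke e0).
have nf1 : (newpos m f).-1 = newpos m f.-1 by rewrite (newpos_pred kf f0).
exists (newpos m e), (newpos m f).
rewrite subgE2 // /kind /g1 /d1 /=; split=> //.
- exact: wf_gd_restr.
- by rewrite /kept_edges /= ke kf.
- by split; rewrite ?newpos_gap // ?(newpos_pred ke e0) // size_restr // newpos_lt_count.
rewrite ne1 nf1 !ptn_restr // !hd_restr // !sgn_restr //; split=> //.
by case: pef => -[-> ->]; auto.
Qed.

Lemma allowedE (L : Type) (g : germ L) t :
  wf (g1 g) -> sep (size (g1 g)) (d1 g) -> (kind g <= 2)%N ->
  allowed g t = all (nth false (amask (g1 g) t)) (dpos (d1 g)).
Proof.
move=> wfG sepE k2; rewrite /allowed k2 eqn0Ngt -has_count -all_predC.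
rewrite (eq_all (a2 := nth false t)); last by move=> a /=; rewrite negbK.
rewrite /darrs -/(dpos _) (eq_all_r (mem_undup _)) all_map.
by apply: eq_in_all => j /(dpos_lt sepE) lt_j; rewrite /= nth_amask.
Qed.

Lemma count_mask (T : Type) (P : pred T) x0 m (s : seq T) : size m = size s ->
  count P (mask m s) = count (fun j => nth false m j && P (nth x0 s j)) (iota 0 (size s)).
Proof.
elim: s m => [|x s IH] [|b m] //= [/IH IHm]; rewrite -[1%N]add1n iotaDl count_map.
rewrite (eq_count (a2 := fun j => nth false m j && P (nth x0 s j))) // -IHm.
by case: b.
Qed.

(** Counting over the positions of [G], and not over the renumbered survivors, allows the signs for
    two masks to be compared position by position. *)
Lemma dsign_restr (G : gdiag) m : size m = size G ->
  dsign (restr G m)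
  = (-1) ^+ (count (fun j => nth false m j && ~~ sgn G j) (iota 0 (size G)))./2.
Proof.
move=> sz; rewrite /dsign /mask_sign; congr (_ ^+ _./2).
rewrite -map_comp (eq_map (g := snd)) // map_mask.
by rewrite (count_mask _ true) size_map.
Qed.

(** * Cancellation between two arrows of opposite signs *)

Section SecondMove.
Variables (G : gdiag) (e f : nat).
Hypotheses (wfgG : wf_gd G) (e0 : (0 < e)%N) (ef : (e.+1 < f)%N) (fN : (f < size G)%N).
Hypothesis pef : (ptn G e.-1 = f.-1 /\ ptn G e = f) \/ (ptn G e.-1 = f /\ ptn G e = f.-1).
Hypotheses (hdE : hd G e.-1 = hd G e) (sgnE : sgn G e.-1 <> sgn G e).
Let E := [:: e; f].
Let wfG : wf G. Proof. by case/wf_gdP: wfgG. Qed.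

Lemma sep2 : sep (size G) E.
Proof. by rewrite /sep /= ef e0 fN /=; lia. Qed.

Let sepE := sep2.
Let eE : e \in E. Proof. by rewrite inE eqxx. Qed.
Let fE : f \in E. Proof. by rewrite !inE eqxx orbT. Qed.
Let lt_e : (e < size G)%N. Proof. exact: ltn_trans (ltnW ef) fN. Qed.
Let lt_e1 : (e.-1 < size G)%N. Proof. exact: leq_ltn_trans (leq_pred e) lt_e. Qed.

Lemma ptn_f : (ptn G f.-1 = e.-1 /\ ptn G f = e) \/ (ptn G f = e.-1 /\ ptn G f.-1 = e).
Proof.
have [_ _ pp _] := wfP _ wfG _ lt_e1; have [_ _ qq _] := wfP _ wfG _ lt_e.
by case: pef => -[<- <-]; auto.
Qed.

Lemma dpos2 j : reflect ([\/ j = e.-1, j = e, j = f.-1 | j = f]) (j \in dpos E).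
Proof.
rewrite /dpos /= !inE; apply: (iffP or4P) => -[] => [/eqP|/eqP|/eqP|/eqP|||| ] ->;
  by rewrite ?eqxx; constructor.
Qed.

Lemma ptn_dpos2 j : j \in dpos E -> ptn G j \in dpos E.
Proof.
case/dpos2=> ->; apply/dpos2; move: pef ptn_f.
- by case=> -[-> _] _; [constructor 3 | constructor 4].
- by case=> -[_ ->] _; [constructor 4 | constructor 3].
- by move=> _ [] [p1 p2]; rewrite ?p1 ?p2; [constructor 1 | constructor 2].
- by move=> _ [] [p1 p2]; rewrite ?p1 ?p2; [constructor 2 | constructor 1].
Qed.

Lemma swp_out j : j \notin dpos E -> swp E j = j.
Proof.
move=> jE; case: (swpP sepE j) => // [j1 _|_ jE' _].
  by case/negP: jE; apply/mem_dpos; exists j.+1; auto.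
by case/negP: jE; apply/mem_dpos; exists j; auto.
Qed.

Lemma swp_vals : [/\ swp E e.-1 = e, swp E e = e.-1, swp E f.-1 = f & swp E f = f.-1].
Proof. by rewrite !(swp_pred sepE) // !(swp_edge sepE). Qed.

(** The pairs at [e] and at [f] each hold one end of either arrow, so [swp E] carries each of the
    two arrows onto the other. *)
Lemma ptn_swp2 j : (j < size G)%N -> ptn G (swp E j) = swp E (ptn G j).
Proof.
move=> lt_j; have [s1 s2 s3 s4] := swp_vals.
have [jE|jE] := boolP (j \in dpos E); last first.
  rewrite (swp_out jE) swp_out //; apply: contra jE => /ptn_dpos2.
  by have [_ _ -> _] := wfP _ wfG _ lt_j.
by case/dpos2: jE => ->; rewrite ?s1 ?s2 ?s3 ?s4; case: pef => -[p1 p2]; case: ptn_f => -[q1 q2];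
  rewrite ?p1 ?p2 ?q1 ?q2 ?s1 ?s2 ?s3 ?s4 //; lia.
Qed.

Lemma hd_swp2 j : (j < size G)%N -> hd G (swp E j) = hd G j.
Proof.
move=> lt_j; have [s1 s2 s3 s4] := swp_vals.
have [_ _ _ h1] := wfP _ wfG _ lt_e1; have [_ _ _ h2] := wfP _ wfG _ lt_e.
have hf : hd G f.-1 = hd G f.
  move: h1 h2 hdE; case: pef => -[-> ->]; by do 4!case: (hd _ _).
have [jE|/swp_out->//] := boolP (j \in dpos E).
by case/dpos2: jE => ->; rewrite ?s1 ?s2 ?s3 ?s4.
Qed.

(** [swp E] commutes with the partner map and preserves heads, so moving all endpoints along it
    reproduces the same unsigned diagram. *)
Lemma forget_swap2 : forgetD (swap G E) = forgetD G.
Proof.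
rewrite forget_swap; have sepF : sep (size (forgetD G)) E by rewrite size_forget.
apply: diag_ext => [|x0 p]; rewrite size_swap // size_forget => lt_p.
have lt_s : (swp E p < size G)%N by rewrite (swp_ltN sepE).
rewrite -{1}(swpK sepE p) nth_swap ?size_forget // [RHS](nth_ep _ (_ : (p < _)%N)) ?size_forget //.
rewrite !ptn_forget !hd_forget -ptn_swp2 // -[in RHS](swpK sepE p) hd_swp2 //.
by congr (_, _); [rewrite (swpK sepE) | case: (_.2); case: (_.2)].
Qed.

Lemma arrow_closed_pull2 m : arrow_closed G m -> arrow_closed G (pull E m).
Proof.
by move/(arrow_closed_pull sepE); rewrite -arrow_closed_forget forget_swap2 arrow_closed_forget.
Qed.

Lemma closed_f m : arrow_closed G m ->
  (nth false m f.-1 = nth false m e.-1 /\ nth false m f = nth false m e) \/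
  (nth false m f = nth false m e.-1 /\ nth false m f.-1 = nth false m e).
Proof.
case/arrow_closedP=> _ H; have := H _ lt_e1; have := H _ lt_e.
by case: pef => -[-> ->] -> ->; auto.
Qed.

(* The mask keeps exactly one of the two cancelling arrows. *)
Let lone m := nth false m e.-1 != nth false m e.

Lemma lone_kept_edges m : arrow_closed G m -> lone m -> kept_edges m E = [::].
Proof.
rewrite /lone /kept_edges /kept => cl; case: (closed_f cl) => -[mf1 mf] /=;
  by rewrite mf1 mf; case: (nth _ _ e.-1); case: (nth _ _ e).
Qed.

(** With a single one of the two arrows left, no distinguished edge survives, so by [restr_swap] the
    swap is invisible after restriction; before restriction it affects only signs. *)
Lemma forget_lone m : arrow_closed G m -> lone m ->
  forgetD (restr G (pull E m)) = forgetD (restr G m).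
Proof.
move=> cl lm; rewrite forget_restr -forget_swap2 -forget_restr.
by rewrite restr_swap // lone_kept_edges // swap_nil.
Qed.

Lemma perm_dpos2 :
  perm_eq (iota 0 (size G)) (dpos E ++ [seq j <- iota 0 (size G) | j \notin dpos E]).
Proof.
rewrite perm_sym; apply: perm_trans (permEl (perm_filterC (mem (dpos E)) _)).
rewrite perm_cat2r; apply: uniq_perm.
- by apply: (sorted_uniq ltn_trans ltnn); rewrite /dpos /=; clear -e0 ef; lia.
- by rewrite filter_uniq // iota_uniq.
- move=> j; rewrite mem_filter mem_iota /=; apply/idP/andP => [jE|[]//].
  by rewrite (dpos_lt sepE jE).
Qed.

(** A mask and its pull differ only in which of the two arrows of opposite signs they keep. *)
Lemma dsign_lone m : arrow_closed G m -> lone m ->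
  dsign (restr G (pull E m)) = - dsign (restr G m).
Proof.
move=> cl lm; have sz := arrow_closed_size cl; have sepm : sep (size m) E by rewrite sz.
(* The four distinguished endpoints are split off; elsewhere [swp E] is the identity and the counts
   agree. *)
rewrite !dsign_restr ?size_pull // !(permP perm_dpos2) !count_cat.
set r := count _ [seq _ <- _ | _]; set r' := count _ [seq _ <- _ | _].
have -> : r = r'.
  apply: eq_in_count => j; rewrite mem_filter => /andP[jE _].
  by rewrite nth_pull // swp_out.
rewrite /= !nth_pull //; have [-> -> -> ->] := swp_vals.
have [ [mf1 [mf [sf1 sf]]] | [mf1 [mf [sf1 sf]]] ] :
    (nth false m f.-1 = nth false m e.-1 /\ nth false m f = nth false m e /\
     sgn G f.-1 = sgn G e.-1 /\ sgn G f = sgn G e) \/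
    (nth false m f.-1 = nth false m e /\ nth false m f = nth false m e.-1 /\
     sgn G f.-1 = sgn G e /\ sgn G f = sgn G e.-1).
- have /wf_gdP[_ sG] := wfgG; have /arrow_closedP[_ mG] := cl.
  move: (mG _ lt_e) (mG _ lt_e1) (sG _ lt_e) (sG _ lt_e1).
  by case: pef => -[-> ->] -> -> -> ->; auto.
all: rewrite mf1 mf sf1 sf; move: lm sgnE; rewrite /lone.
all: case: (nth false m e.-1); case: (nth false m e) => // _.
(* A negative arrow adds two positions to the count, hence one factor -1 after halving. *)
all: by case: (sgn G e.-1); case: (sgn G e) => // _; rewrite /= ?add0n ?addn0 ?exprS ?mulN1r ?opprK.
Qed.

(** [pull E] is a sign-reversing involution on these masks, so the sum equals its own negative. *)
Lemma sum_lone (A : adiag) : \sum_(m <- vmasks G | lone m) weight A (restr G m) = 0.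
Proof.
suff H : \sum_(m <- vmasks G | lone m) weight A (restr G m)
       = - \sum_(m <- vmasks G | lone m) weight A (restr G m).
  by move/eqP: H; rewrite -addr_eq0 -mulr2n Num.Theory.mulrn_eq0 => /eqP.
rewrite -sumrN -[LHS]big_filter
  -(perm_big _ (_ : perm_eq [seq pull E m | m <- vmasks G & lone m] _)).
  rewrite big_map big_filter big_seq_cond [RHS]big_seq_cond; apply: eq_bigr => m.
  rewrite mem_vmasks => /andP[cl lm]; rewrite /weight forget_lone // dsign_lone //.
  by case: eqP; rewrite ?oppr0.
have lone_pull m : arrow_closed G m -> lone (pull E m) = lone m.
  move=> /arrow_closed_size sz; rewrite /lone !nth_pull ?sz //.
  by have [-> -> _ _] := swp_vals; rewrite eq_sym.
have pullmK m : arrow_closed G m -> pull E (pull E m) = m.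
  by move=> /arrow_closed_size sz; rewrite pullK ?sz.
apply: uniq_perm; [rewrite map_inj_in_uniq| |].
- by rewrite filter_uniq // uniq_vmasks.
- move=> m n; rewrite [m \in _]mem_filter [n \in _]mem_filter !mem_vmasks.
  by move=> /andP[_ clm] /andP[_ cln] /(congr1 (pull E)); rewrite !pullmK.
- by rewrite filter_uniq // uniq_vmasks.
move=> m; rewrite [RHS]mem_filter mem_vmasks; apply/mapP/andP => [[n + ->]|[lm cl]].
  by rewrite mem_filter mem_vmasks => /andP[ln cln]; rewrite lone_pull // arrow_closed_pull2.
exists (pull E m); last by rewrite pullmK.
by rewrite mem_filter mem_vmasks lone_pull // lm arrow_closed_pull2.
Qed.

Lemma kept_dpos2 m : arrow_closed G m ->
  all (nth false m) (dpos E) = nth false m e.-1 && nth false m e /\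
  has (nth false m) (dpos E) = nth false m e.-1 || nth false m e.
Proof.
move=> cl; rewrite /dpos /=; case: (closed_f cl) => -[-> ->];
  by case: (nth false m e.-1); case: (nth false m e).
Qed.

(** A subset holds both arrows, neither or exactly one; [sum_lone] disposes of the last kind. *)
Lemma sum_second_move (A : adiag) :
  \sum_(m <- vmasks G | all (nth false m) (dpos E)) weight A (restr G m)
  = \sum_(m <- vmasks G) weight A (restr G m)
    - \sum_(m <- vmasks G | ~~ has (nth false m) (dpos E)) weight A (restr G m).
Proof.
apply/eqP; rewrite eq_sym subr_eq eq_sym; apply/eqP.
rewrite [RHS](bigID (fun m => all (nth false m) (dpos E))); congr (_ + _).
rewrite [RHS](bigID lone) -[LHS]add0r -[X in X + _ = _](sum_lone A); congr (_ + _);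
  rewrite big_seq_cond [RHS]big_seq_cond; apply: eq_bigl => m; rewrite mem_vmasks;
  apply: andb_id2l => /kept_dpos2[allE hasE]; rewrite ?allE ?hasE /lone;
  by case: (nth false m e.-1); case: (nth false m e).
Qed.

End SecondMove.

(** * The adjunction *)

Lemma ev_bd_g (F : gdiag -> rat) g : ev F (bd_g g) = F (g1 g) - F (g0 g).
Proof. by rewrite /ev big_cons big_seq1 mul1r mulN1r. Qed.

Lemma ev_I_g (F : germ bool -> rat) g :
  ev F (I_g g) = \sum_(t <- bseqs (narrows (g1 g)) | allowed g t) F (subg g (amask (g1 g) t)).
Proof. exact: ev_seq1. Qed.

Lemma ev_I_d (A : adiag) (G : gdiag) : wf A -> wf_gd G ->
  ev (fun H => ev (fun u => (u == H)%:R) (S_d A)) (I_d G)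
  = \sum_(m <- vmasks G) weight A (restr G m).
Proof.
move=> wfA wfgG; have /wf_gdP[wfG _] := wfgG.
rewrite -(sum_amask (fun m => weight A (restr G m)) wfG) /ev big_map.
apply: eq_bigr => t _ /=; rewrite mul1r [LHS]ev_S_d //.
by apply: wf_gd_restr => //; apply: arrow_closed_amask.
Qed.

Lemma subg_weight (A : adiag) g m : wf A -> is_germ (subg g m) -> (kind g <= 2)%N ->
  ev (fun a => ev (bG^~ (subg g m)) (S_g a)) (d_d A) = weight A (restr (g1 g) m).
Proof.
move=> wfA germ_s k2; have ks : kind (subg g m) = kind g by rewrite subgE2.
rewrite ev_coboundary //; last by rewrite ks ltnNge k2.
by rewrite ks ltnNge k2 mul0r subr0 subgE2.
Qed.

(** The case of one diagram and one germ. On the left each subgerm is paired with the whole of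
    [d_d A], so that both sides become sums of weights over arrow subsets of [G1]. *)
Lemma adjunction (A : adiag) g : wf A -> is_germ_G1 g ->
  ev (fun v => ev (fun a => ev (bG^~ v) (S_g a)) (d_d A)) (I_g g)
  = ev (fun D => ev (fun H => ev (fun u => (u == H)%:R) (S_d A)) (I_d D)) (bd_g g).
Proof.
move=> wfA [germ_g k123]; have [wfgG sepE] := germ_wf_sep germ_g.
have /wf_gdP[wfG _] := wfgG.
pose W m := weight A (restr (g1 g) m).
have [k2|k3] := leqP (kind g) 2; last first.
  have g3 : is_germ3 g.
    by case/germ_kind: germ_g k123 k3 => -[k_ // g3]; rewrite k_.
  have g0E : g0 g = swap (g1 g) (d1 g) by rewrite -(g1_rev k3).
  rewrite ev_bd_g g0E !ev_I_d //; last exact: wf_gd_swap.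
  (* The subset of [G0] matched with [m] is its pull; both sums then run over subsets of [G1] and
     are compared term by term. *)
  rewrite sum_pull // -sumrB -(sum_amask (fun m => W m - weight A _) wfG) ev_I_g big_mkcond.
  apply: eq_bigr => t _; set m := amask _ t.
  have cl : arrow_closed (g1 g) m by apply: arrow_closed_amask.
  case: ifPn => [al|nal]; last first.
    (* No distinguished edge survives, so the swap is along the empty list and the two subdiagrams
       coincide. *)
    by rewrite restr_swap // (kept_edges_nil g3 (erefl m) nal) swap_nil subrr.
  have [germ_s ks rev_s] := subg_allowed g3 (erefl m) al.
  rewrite ev_coboundary // ks mul1r rev_sub // !subgE ?germ3_kind //; last exact: germ3_rev.
  by rewrite /W [g1 (rev_germ g)]g1_rev.
have posk : kind g = 1%N \/ kind g = 2%N.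
  by case/germ_kind: germ_g k2 => -[-> _]; auto.
have g0E : g0 g = restr (g1 g) (nmask (g1 g) (d1 g)) by rewrite /g0 k2.
have sub_germ m : arrow_closed (g1 g) m -> all (nth false m) (dpos (d1 g)) -> is_germ (subg g m).
  rewrite -all_kept => cl km; have ks : kind (subg g m) = kind g by rewrite subgE2.
  rewrite /is_germ ks.
  case: posk germ_g => kg; rewrite /is_germ kg => gg; first exact: germ1_sub.
  exact: germ2_sub.
have ptn_d j : j \in dpos (d1 g) -> ptn (g1 g) j \in dpos (d1 g).
  case/germ_kind: germ_g k2 =>
    [[_ [e [_ _ dE be pe]]]|[_ [e [f [_ _ dE [e0 ef fN] [pef h s]]]]]|[->]|[->]] // _.
    have lt1 : (e.-1 < size (g1 g))%N by lia.
    have [_ _ pp _] := wfP _ wfG _ lt1.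
    have pe' : ptn (g1 g) e = e.-1 by rewrite -{1}pe.
    by rewrite dE /dpos /= !inE => /orP[] /eqP->; rewrite ?pe ?pe' eqxx ?orbT.
  by rewrite dE; apply: ptn_dpos2.
have lhs : ev (fun v => ev (fun a => ev (bG^~ v) (S_g a)) (d_d A)) (I_g g)
    = \sum_(m <- vmasks (g1 g) | all (nth false m) (dpos (d1 g))) W m.
  rewrite ev_I_g big_mkcond [RHS]big_mkcond -sum_amask //; apply: eq_bigr => t _.
  rewrite allowedE //; case: ifP => // al; rewrite subg_weight //.
  by apply: sub_germ => //; apply: arrow_closed_amask.
rewrite lhs ev_bd_g g0E !ev_I_d //; last first.
  by apply: wf_gd_restr => //; apply: arrow_closed_nmask.
rewrite (sum_erase wfG sepE ptn_d (weight A)).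
case/germ_kind: germ_g k2 =>
    [[_ [e [_ _ dE be pe]]]|[_ [e [f [_ _ -> [e0 ef fN] [pef h s]]]]]|[->]|[->]] // _.
  (* A first move has a single distinguished arrow, so a closed mask that does not keep all
     distinguished positions keeps none. *)
  rewrite [X in _ = X - _](bigID (fun m => all (nth false m) (dpos (d1 g)))) /=.
  rewrite -addrA -[LHS]addr0; congr (_ + _); apply/esym/eqP; rewrite subr_eq0; apply/eqP.
  rewrite big_seq_cond [RHS]big_seq_cond; apply: eq_bigl => m; rewrite mem_vmasks.
  apply: andb_id2l => /arrow_closedP[_ H]; rewrite dE /dpos /= andbT orbF.
  have lt1 : (e.-1 < size (g1 g))%N by lia.
  by move: (H _ lt1); rewrite pe => ->; case: (nth _ _ _).
exact: sum_second_move.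
Qed.

(** Bilinearity reduces the identity to [adjunction]. The hypotheses say that the entries of the two
    lists encode genuine arrow diagrams and germs. *)
Theorem theorem1p4 (A : lc adiag) (gam : lc (germ bool)) :
  (forall u, u \in A -> wf u.2) ->
  (forall u, u \in gam -> is_germ_G1 u.2) ->
  pairG (lin d_d A) gam = pairD A (lin bd_g gam).
Proof.
move=> wfA germ_gam; rewrite pairGE pairDE ev_lin.
apply: eq_ev => a /wfA wfa; rewrite [RHS]ev_lin ev_exchange.
apply: eq_ev => g /germ_gam germ_g; rewrite -adjunction // ev_exchange.
by [].
Qed.
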